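(* Let $K$ be a field such that $\mathrm{cd}(K(\mathbf i))\leq 1$, where $\mathbf i=\sqrt{-1}$ and $\mathrm{cd}$ denotes cohomological dimension (of the absolute Galois group). Then the strong Massey vanishing conjecture holds for $K$ with respect to every prime number; that is, for every prime number $p$ different from the characteristic of $K$, the absolute Galois group $G(K)$ of $K$ has the strong Massey vanishing property with respect to $p$.
   Context: Massey products. Let $p$ be a prime, let $G$ be a profinite group, and let $\mathcal C^*$ be the differential graded associative algebra of continuous (inhomogeneous) cochains of $G$ with coefficients in $\mathbb Z/p$ (trivial action), with cup product $\cup$, differential $\delta$, and cohomology $H^*=H^*(G,\mathbb Z/p)$. Let $n\geq 2$ and $a_1,\ldots,a_n\in H^1(G,\mathbb Z/p)$. A defining system for the $n$-fold Massey product of $a_1,\ldots,a_n$ is a family of elements $a_{ij}\in\mathcal C^1$, indexed by $1\leq i<j\leq n+1$ with $(i,j)\neq(1,n+1)$, such that $$\delta(a_{ij})=\sum_{k=i+1}^{j-1}a_{ik}\cup a_{kj}$$ and such that $a_{12},a_{23},\ldots,a_{n,n+1}$ represent $a_1,a_2,\ldots,a_n$. The $n$-fold Massey product with respect to this defining system is the class of $\sum_{k=2}^n a_{1k}\cup a_{k,n+1}$ in $H^2(G,\mathbb Z/p)$. The set $\langle a_1,\ldots,a_n\rangle\subseteq H^2(G,\mathbb Z/p)$ consists of the Massey products with respect to all defining systems. The $n$-fold Massey product of $a_1,\ldots,a_n$ vanishes if $0\in\langle a_1,\ldots,a_n\rangle$. $G$ has the strong Massey vanishing property with respect to $p$ if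 for every integer $n\geq 3$ and all $a_1,\ldots,a_n\in H^1(G,\mathbb Z/p)$ with $a_i\cup a_{i+1}=0$ for every $1\leq i<n$, the $n$-fold Massey product of $a_1,\ldots,a_n$ vanishes. For a field $K$ of characteristic different from $p$, the strong Massey vanishing conjecture with respect to $p$ is said to hold for $K$ if its absolute Galois group $G(K)$ has the strong Massey vanishing property with respect to $p$. *)

(* Defs.v *)
From HB Require Import structures.
From mathcomp Require Import all_boot all_order all_algebra all_field.
From mathcomp Require Import generic_quotient ring_quotient ring.
From mathcomp Require Import boolp classical_sets functions filter.
From mathcomp Require Import topology_structure product_topology.
From mathcomp Require Import initial_topology.
From mathcomp Require Import supremum_topology discrete_topology.
From mathcomp Require Import function_spaces.
Set Implicit Arguments.
Unset Strict Implicit.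
Unset Printing Implicit Defensive.
Import GRing.Theory.
Local Open Scope classical_set_scope.
Local Open Scope ring_scope.

HB.mixin Record isTopologicalGroup G & Group G & Topological G := {
  mulg_continuous : continuous (fun x : G * G => (x.1 * x.2)%g);
  invg_continuous : continuous (fun x : G => x^-1%g)
}.

#[short(type="topologicalGroupType")]
HB.structure Definition TopologicalGroup :=
  {G of Group G & Topological G & isTopologicalGroup G}.

Lemma discrete_continuousP (T : topologicalType) (A : choiceType)
    (f : T -> discrete_topology A) :
  continuous f <-> forall x, \forall y \near x, f y = f x.
Proof.
split=> fC x; first exact: (fC x [set f x] (discrete_set1 _)).
by apply/discrete_cvg; exact: fC.
Qed.

Section DiscreteModules.
Variable G : topologicalGroupType.

Record discreteModule := DiscreteModule {
  dmod_sort :> zmodType;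
  dact : G -> dmod_sort -> dmod_sort;
  dact1 : forall a, dact 1%g a = a;
  dactM : forall g h a, dact (g * h)%g a = dact g (dact h a);
  dactD : forall g, {morph dact g : a b / a + b};
  dact_continuous :
    continuous (fun x : G * discrete_topology dmod_sort =>
                  dact x.1 x.2 : discrete_topology dmod_sort)
}.

Fact trivial_continuous (A : zmodType) :
  continuous (fun x : G * discrete_topology A => x.2).
Proof. by move=> x; exact: cvg_snd. Qed.

Definition trivialModule (A : zmodType) : discreteModule :=
  @DiscreteModule A (fun _ a => a) (fun _ => erefl) (fun _ _ _ => erefl)
    (fun _ _ _ => erefl) (@trivial_continuous A).

End DiscreteModules.

(* Continuous inhomogeneous cochains. A point of G ^ n is indexed from 0. *)
Section Cochains.
Variables (G : topologicalGroupType) (A : discreteModule G).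

Definition pow n := {ptws 'I_n -> G}.

Definition continuous_pred n : {pred pow n -> A} :=
  fun f => `[< continuous (f : pow n -> discrete_topology A) >].

Fact continuous_predP n (f : pow n -> A) :
  reflect (forall x, \forall y \near x, f y = f x) (f \in @continuous_pred n).
Proof.
by apply: (iffP (asboolP _)) => /(@discrete_continuousP (pow n) A f).
Qed.

Fact continuous_zmod n : zmod_closed (@continuous_pred n).
Proof.
split=> [|f g /continuous_predP fC /continuous_predP gC];
  apply/continuous_predP.
  by move=> x; near=> y.
move=> x; near=> y; rewrite !fctE.
have -> : f y = f x by near: y; exact: fC.
by have -> : g y = g x by near: y; exact: gC.
Unshelve. all: by end_near. Qed.

HB.instance Definition _ n :=
  GRing.isZmodClosed.Build (pow n -> A) (@continuous_pred n)
    (@continuous_zmod n).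

Record cochain n := Cochain {
  cochain_fun :> pow n -> A;
  cochain_continuous : cochain_fun \in @continuous_pred n
}.

HB.instance Definition _ n := [isSub of cochain n for @cochain_fun n].
HB.instance Definition _ n := [Choice of cochain n by <:].
HB.instance Definition _ n := [SubChoice_isSubZmodule of cochain n by <:].

(* [belast_pow], [behead_pow] and [contract i] map (x_0, ..., x_n) to
   (x_0, ..., x_(n-1)), (x_1, ..., x_n) and
   (x_0, ..., x_i * x_(i+1), ..., x_n) respectively. *)
Definition belast_pow n (x : pow n.+1) : pow n := fun j => x (lift ord_max j).
Definition behead_pow n (x : pow n.+1) : pow n := fun j => x (lift ord0 j).
Definition contract n (i : 'I_n) (x : pow n.+1) : pow n := fun j =>
  if (j < i)%N then x (lift ord_max j)
  else if j == i then (x (lift ord_max j) * x (lift ord0 j))%g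
  else x (lift ord0 j).

Definition dfun n (f : pow n -> A) (x : pow n.+1) : A :=
  dact (x ord0) (f (behead_pow x))
  + \sum_(i < n) f (contract i x) *~ (-1) ^+ i.+1
  + f (belast_pow x) *~ (-1) ^+ n.+1.

Lemma coord_continuous n (j : 'I_n) : continuous (fun x : pow n => x j).
Proof. exact: (@proj_continuous _ (fun=> G : topologicalType) j). Qed.

Lemma pow_continuous (T : topologicalType) n (h : T -> pow n) :
  (forall j, continuous (fun x => h x j)) -> continuous h.
Proof.
move=> hC x; apply/cvg_sup => j.
exact: (@continuous_comp_initial _ T G (fun f : 'I_n -> G => f j) h (hC j) x).
Qed.

Let belast_powC n : continuous (@belast_pow n).
Proof. by apply: pow_continuous => j; apply: coord_continuous. Qed.

Let behead_powC n : continuous (@behead_pow n).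
Proof. by apply: pow_continuous => j; apply: coord_continuous. Qed.

Let contractC n i : continuous (@contract n i).
Proof.
apply: pow_continuous => j; rewrite /contract; case: (j < i)%N.
  exact: coord_continuous.
case: (j == i) => x; last exact: coord_continuous.
apply: (@continuous2_cvg (pow n.+1) G G G (nbhs x) _
  (fun y => y (lift ord_max j)) (fun y => y (lift ord0 j))
  (fun a b => (a * b)%g)); [|exact: coord_continuous|exact: coord_continuous].
exact: (@mulg_continuous G (x (lift ord_max j), x (lift ord0 j))).
Qed.

Lemma cochain_near (T : topologicalType) n (f : cochain n)
    (h : T -> pow n) (x : T) :
  continuous h -> \forall y \near x, f (h y) = f (h x).
Proof.
move=> hC; have /continuous_predP/(_ (h x)) := cochain_continuous f.
exact: (hC x).
Qed.

Fact dfun_continuous n (f : cochain n) : dfun f \in @continuous_pred n.+1.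
Proof.
apply/continuous_predP => x.
have C1 : \forall y \near x,
    dact (y ord0) (f (behead_pow x)) = dact (x ord0) (f (behead_pow x)).
  pose b : discrete_topology A := f (behead_pow x).
  have act_near : \forall z \near (x ord0, b), dact z.1 z.2 = dact (x ord0) b.
    have := @dact_continuous G A.
    by move=> /(@discrete_continuousP _ A)/(_ (x ord0, b)).
  have pairC : (fun y : pow n.+1 => (y ord0, b)) @ x --> (x ord0, b).
    apply: (@cvg_pair (pow n.+1) G (discrete_topology A) (nbhs x)
      (nbhs (x ord0)) (nbhs b)) => /=.
      exact: coord_continuous.
    exact: cvg_cst.
  exact: pairC act_near.
have C2 := cochain_near f x (@behead_powC n).
have C3 := cochain_near f x (@belast_powC n).
have C4 : \forall y \near x, forall i, f (contract i y) = f (contract i x).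
  apply: (@filter_forall _ 'I_n (fun i y => f (contract i y) = f (contract i x))
    (nbhs x) _) => i; exact: cochain_near (@contractC n i).
near=> y.
have E1 : dact (y ord0) (f (behead_pow x)) = dact (x ord0) (f (behead_pow x)).
  by near: y; exact: C1.
have E2 : f (behead_pow y) = f (behead_pow x) by near: y; exact: C2.
have E3 : f (belast_pow y) = f (belast_pow x) by near: y; exact: C3.
have E4 : forall i, f (contract i y) = f (contract i x).
  by near: y; exact: C4.
by rewrite /dfun E2 E1 E3; under eq_bigr do rewrite E4.
Unshelve. all: by end_near. Qed.

Definition differential n (f : cochain n) : cochain n.+1 :=
  Cochain (dfun_continuous f).

Fact differential_zmod n : zmod_morphism (@differential n).
Proof.
move=> f g; apply/val_inj/funext => x; rewrite /= /dfun.
have dactB (h : G) (a b : A) : dact h (a - b) = dact h a - dact h b.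
  by apply/eqP; rewrite eq_sym subr_eq -dactD subrK.
rewrite !fctE dactB mulrzBl.
under eq_bigr do rewrite mulrzBl.
by rewrite sumrB (addrACA (dact _ _)) -opprD addrACA -opprD.
Qed.

HB.instance Definition _ n := GRing.isZmodMorphism.Build
  (cochain n) (cochain n.+1) (@differential n) (@differential_zmod n).

Definition cocycle_pred n : {pred cochain n} := fun f => differential f == 0.

Fact cocycle_zmod n : zmod_closed (@cocycle_pred n).
Proof.
split=> [|f g /eqP fZ /eqP gZ]; apply/eqP; first exact: raddf0.
by rewrite raddfB /= fZ gZ subrr.
Qed.

HB.instance Definition _ n :=
  GRing.isZmodClosed.Build (cochain n) (@cocycle_pred n) (@cocycle_zmod n).

Record cocycle n := Cocycle {
  cocycle_val :> cochain n;
  cocycleP : cocycle_val \in @cocycle_pred n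
}.

HB.instance Definition _ n := [isSub of cocycle n for @cocycle_val n].
HB.instance Definition _ n := [Choice of cocycle n by <:].
HB.instance Definition _ n := [SubChoice_isSubZmodule of cocycle n by <:].

Definition is_coboundary n : cochain n -> Prop :=
  match n with
  | 0 => fun f => f = 0
  | m.+1 => fun f => exists g : cochain m, f = differential g
  end.

Definition coboundary_pred n : {pred cocycle n} :=
  fun f => `[< is_coboundary (f : cochain n) >].

Fact coboundary_zmod n : zmod_closed (@coboundary_pred n).
Proof.
split=> [|f g /asboolP fB /asboolP gB]; apply/asboolP.
  by case: n => [|n] //=; exists 0; rewrite raddf0.
case: n f g fB gB => [|n] f g /= => [-> -> |[f' ->] [g' ->]].
  by rewrite subrr.
by exists (f' - g'); rewrite raddfB.
Qed.

HB.instance Definition _ n := GRing.isZmodClosed.Build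
  (cocycle n) (@coboundary_pred n) (@coboundary_zmod n).

Definition cohomology n := Quotient.quot (@coboundary_pred n).

HB.instance Definition _ n := GRing.Zmodule.on (cohomology n).

Definition cohomology_class n (f : cocycle n) : cohomology n :=
  \pi_(Quotient.quot (@coboundary_pred n))%qT f.

Lemma cohomology_classP n (f g : cocycle n) :
  cohomology_class f = cohomology_class g <-> is_coboundary (f - g : cochain n).
Proof.
have -> : is_coboundary (f - g : cochain n) <-> f - g \in @coboundary_pred n.
  by split=> /asboolP.
by rewrite Quotient.idealrBE; split=> /eqP.
Qed.

Definition represents n (f : cochain n) (c : cohomology n) : Prop :=
  exists2 z : cocycle n, f = z & cohomology_class z = c.

End Cochains.

Section Massey.
Variables (G : topologicalGroupType) (p : nat).

Local Notation Fp := (trivialModule G 'F_p).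
Local Notation "'C^ n" := (cochain Fp n) (at level 8, n at level 2).
Local Notation "'Z^ n" := (cocycle Fp n) (at level 8, n at level 2).
Local Notation "'H^ n" := (cohomology Fp n) (at level 8, n at level 2).

Definition cup_fun m n (f : 'C^m) (g : 'C^n) (x : pow G (m + n)) : 'F_p :=
  (f (fun i => x (lshift n i)) : 'F_p) * g (fun j => x (rshift m j)).

Fact cup_continuous m n (f : 'C^m) (g : 'C^n) :
  cup_fun f g \in @continuous_pred G Fp (m + n).
Proof.
apply/continuous_predP => x.
have Cf := @cochain_near _ Fp (pow G (m + n)) m f
  (fun y i => y (lshift n i)) x.
have Cg := @cochain_near _ Fp (pow G (m + n)) n g
  (fun y i => y (rshift m i)) x.
near=> y; rewrite /cup_fun; congr (_ * _); near: y.
  by apply: Cf; apply: pow_continuous => j; apply: coord_continuous.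
by apply: Cg; apply: pow_continuous => j; apply: coord_continuous.
Unshelve. all: by end_near. Qed.

Definition cup m n (f : 'C^m) (g : 'C^n) : 'C^(m + n) :=
  Cochain (cup_continuous f g).

Lemma cochain1E (f : 'C^1) (x : pow G 1) : f x = f (fun=> x ord0).
Proof. by congr (cochain_fun f _); apply/funext => i; rewrite (ord1 i). Qed.

Lemma cocycle1M (f : 'Z^1) (g h : G) :
  f (fun=> (g * h)%g) = f (fun=> g) + f (fun=> h) :> 'F_p.
Proof.
pose u : pow G 2 := fun i => if i == ord0 then g else h.
have : differential f u = 0 by rewrite (eqP (cocycleP f)).
rewrite /= /dfun big_ord1 expr1 mulrN1z sqrrN expr1n mulr1z => /eqP.
rewrite [X in _ - X + _]cochain1E [X in _ + X == _]cochain1E /=.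
rewrite addrAC subr_eq0 addrC => /eqP <-.
by congr (_ + _); rewrite cochain1E.
Qed.

Fact cup1_cocycle (f g : 'Z^1) : cup f g \in @cocycle_pred G Fp 2.
Proof.
apply/eqP/val_inj/funext => x.
rewrite /= /dfun !big_ord_recl big_ord0 /= addr0.
rewrite expr1 mulrN1z sqrrN expr1n mulr1z.
rewrite exprS sqrrN expr1n mulr1 mulrN1z.
have cupE (y : pow G 2) s t : y ord0 = s -> y ord_max = t ->
    cup_fun f g y = f (fun=> s) * g (fun=> t) :> 'F_p.
  rewrite /cup_fun cochain1E (cochain1E g) => <- <-.
  have -> : lshift 1 (ord0 : 'I_1) = ord0 by apply: val_inj.
  by have -> : rshift 1 (ord0 : 'I_1) = ord_max by apply: val_inj.
pose x1 := x (lift ord0 ord0).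
have -> : cup_fun f g (behead_pow x) = f (fun=> x1) * g (fun=> x ord_max).
  by apply: cupE; congr x; apply: val_inj.
have -> : cup_fun f g (contract ord0 x)
    = f (fun=> (x ord0 * x1)%g) * g (fun=> x ord_max).
  apply: cupE; rewrite /contract /=; last by congr x; apply: val_inj.
  by congr (x _ * x _)%g; apply: val_inj.
have -> : cup_fun f g (contract (lift ord0 ord0) x)
    = f (fun=> x ord0) * g (fun=> (x1 * x ord_max)%g).
  apply: cupE; rewrite /contract /=; first by congr x; apply: val_inj.
  by congr (x _ * x _)%g; apply: val_inj.
have -> : cup_fun f g (belast_pow x) = f (fun=> x ord0) * g (fun=> x1).
  by apply: cupE; congr x; apply: val_inj.
rewrite !cocycle1M (_ : (0 : pow G 3 -> 'F_p) x = 0) //; ring.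
Qed.

Definition cup1 (f g : 'Z^1) : 'Z^2 := Cocycle (cup1_cocycle f g).

Lemma coboundary1_eq0 (f : 'C^1) : is_coboundary f -> f = 0.
Proof.
case=> h ->; apply/val_inj/funext => x.
rewrite /= /dfun big_ord0 addr0 expr1 mulrN1z.
apply/eqP; rewrite subr_eq0; apply/eqP.
by congr (cochain_fun h _); apply/funext => -[].
Qed.

Lemma repr_cohomology1 (f : 'Z^1) : repr (cohomology_class f) = f.
Proof.
have /cohomology_classP/coboundary1_eq0/eqP :
    cohomology_class (repr (cohomology_class f)) = cohomology_class f.
  by rewrite /cohomology_class reprK.
by rewrite subr_eq0 => /eqP/val_inj.
Qed.

Definition cupH (a b : 'H^1) : 'H^2 :=
  cohomology_class (cup1 (repr a) (repr b)).

Lemma cupH_class (f g : 'Z^1) :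
  cupH (cohomology_class f) (cohomology_class g) = cohomology_class (cup1 f g).
Proof. by rewrite /cupH !repr_cohomology1. Qed.

(* Only the values a i with 1 <= i <= n, and the values A i j with
   1 <= i < j <= n + 1 and (i, j) <> (1, n + 1), matter below. *)
Definition defining_system n (a : nat -> 'H^1)
    (A : nat -> nat -> 'C^1) : Prop :=
  (forall i j, (1 <= i)%N -> (i < j)%N -> (j <= n.+1)%N ->
     (i, j) != (1, n.+1)%N ->
     differential (A i j) = \sum_(i.+1 <= k < j) cup (A i k) (A k j))
  /\ (forall i, (1 <= i <= n)%N -> represents (A i i.+1) (a i)).

Definition massey_product n (a : nat -> 'H^1) : set 'H^2 :=
  [set c | exists2 A, defining_system n a A &
     represents (\sum_(2 <= k < n.+1) cup (A 1%N k) (A k n.+1)) c].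

Definition massey_vanishes n (a : nat -> 'H^1) : Prop := massey_product n a 0.

Definition strong_massey_vanishing : Prop :=
  forall (n : nat) (a : nat -> 'H^1), (3 <= n)%N ->
    (forall i, (1 <= i < n)%N -> cupH (a i) (a i.+1) = 0) ->
    massey_vanishes n a.

End Massey.

Section CohomologicalDimension.
Variable G : topologicalGroupType.

Definition torsion (A : zmodType) : Prop :=
  forall a : A, exists2 m, (0 < m)%N & a *+ m = 0.

Definition p_primary_part (p : nat) (A : zmodType) : set A :=
  [set a | exists k, a *+ (p ^ k) = 0].
Arguments p_primary_part : clear implicits.

Definition cdp_le (p n : nat) : Prop :=
  forall A : discreteModule G, torsion A ->
  forall q, (n < q)%N -> p_primary_part p (cohomology A q) = [set 0].

Definition cd_le (n : nat) : Prop := forall p, prime p -> cdp_le p n.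

End CohomologicalDimension.

Section GaloisGroup.
Variables (K L : fieldType) (iota : {rmorphism K -> L}).

Definition separable_closure : Prop :=
  (forall x : L, exists2 q : {poly K},
     separable_poly q & root (map_poly iota q) x)
  /\ (forall q : {poly L}, separable_poly q -> (1 < size q)%N ->
        exists x, root q x).

Definition is_galg (s : L -> L) : Prop :=
  [/\ zmod_morphism s, monoid_morphism s, bijective s
    & forall x, s (iota x) = iota x].

Record galoisGroup := GaloisAut {
  galg_fun :> L -> L;
  galgP : `[< is_galg galg_fun >]
}.

HB.instance Definition _ := [isSub of galoisGroup for galg_fun].
HB.instance Definition _ := [Choice of galoisGroup by <:].

Fact galg1_subproof : `[< is_galg id >].
Proof. by apply/asboolP; split=> //; exists id. Qed.

Definition galg1 : galoisGroup := GaloisAut galg1_subproof.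

Fact galgM_subproof (s t : galoisGroup) : `[< is_galg (s \o t) >].
Proof.
have [sB [s1 sM] sV sK] := asboolP _ (galgP s).
have [tB [t1 tM] tV tK] := asboolP _ (galgP t).
apply/asboolP; split; last by move=> x /=; rewrite tK sK.
- by move=> x y /=; rewrite tB sB.
- by split=> [|x y] /=; [rewrite t1 s1 | rewrite tM sM].
- exact: bij_comp.
Qed.

Definition galgM (s t : galoisGroup) : galoisGroup :=
  GaloisAut (galgM_subproof s t).

Fact galgV_exists (s : galoisGroup) :
  exists t : galoisGroup, cancel s t /\ cancel t s.
Proof.
have [sB [s1 sM] [t sK tK] sF] := asboolP _ (galgP s).
suff tP : `[< is_galg t >] by exists (GaloisAut tP).
have tI : injective s by exact: can_inj sK.
apply/asboolP; split; last by move=> x; rewrite -(sF x) sK sF.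
- by move=> x y; apply: tI; rewrite sB !tK.
- by split=> [|x y]; apply: tI; rewrite ?s1 ?sM !tK.
- by exists s.
Qed.

Definition galgV (s : galoisGroup) : galoisGroup :=
  projT1 (cid (galgV_exists s)).

Fact galgVK (s : galoisGroup) : cancel s (galgV s) /\ cancel (galgV s) s.
Proof. exact: projT2 (cid (galgV_exists s)). Qed.

Fact galgMA : associative galgM. Proof. by move=> s t u; apply: val_inj. Qed.
Fact galg1M : left_id galg1 galgM. Proof. by move=> s; apply: val_inj. Qed.
Fact galgM1 : right_id galg1 galgM. Proof. by move=> s; apply: val_inj. Qed.
Fact galgVM : left_inverse galg1 galgV galgM.
Proof. by move=> s; apply/val_inj/funext => x; exact: (galgVK s).1. Qed.
Fact galgMV : right_inverse galg1 galgV galgM.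
Proof. by move=> s; apply/val_inj/funext => x; exact: (galgVK s).2. Qed.

HB.instance Definition _ :=
  isGroup.Build galoisGroup galgMA galg1M galgM1 galgVM galgMV.

(* The Krull topology: a finite extension of K inside L is generated by some
   finite sequence u, and [galg_coset s u] is the coset s * Gal(L / K(u)). *)
Definition galg_coset (s : galoisGroup) (u : seq L) : set galoisGroup :=
  [set t : galoisGroup | {in u, t =1 s}].

Definition galg_nbhs (s : galoisGroup) : set_system galoisGroup :=
  [set B | exists u, galg_coset s u `<=` B].

Fact galg_nbhs_filter (s : galoisGroup) : ProperFilter (galg_nbhs s).
Proof.
apply: Build_ProperFilter_ex => [B [u uB]|]; first by exists s; apply: uB.
split; first by exists [::].
- move=> B C [u uB] [v vC]; exists (u ++ v) => t ts; split.
    by apply: uB => x xu; rewrite ts // mem_cat xu.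
  by apply: vC => x xv; rewrite ts // mem_cat xv orbT.
- by move=> B C BC [u uB]; exists u; apply: subset_trans BC.
Qed.

Fact galg_nbhs_singleton (s : galoisGroup) (B : set galoisGroup) :
  galg_nbhs s B -> B s.
Proof. by move=> [u uB]; apply: uB. Qed.

Fact galg_nbhs_nbhs (s : galoisGroup) (B : set galoisGroup) :
  galg_nbhs s B -> galg_nbhs s (galg_nbhs^~ B).
Proof.
move=> [u uB]; exists u => t ts; exists u => r rt; apply: uB => x xu.
by rewrite rt // ts.
Qed.

HB.instance Definition _ := hasNbhs.Build galoisGroup galg_nbhs.
HB.instance Definition _ := Nbhs_isNbhsTopological.Build galoisGroup
  galg_nbhs_filter galg_nbhs_singleton galg_nbhs_nbhs.

Fact galgM_continuous :
  continuous (fun x : galoisGroup * galoisGroup => (x.1 * x.2)%g).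
Proof.
move=> [s t] B [u uB].
exists (galg_coset s (map t u), galg_coset t u).
  by split; [exists (map t u) | exists u].
move=> [s' t'] /= [ss tt]; apply: uB => x xu /=.
change (s' (t' x) = s (t x)).
by rewrite (tt x xu) ss //; exact: map_f.
Qed.

Fact galgV_continuous : continuous (fun x : galoisGroup => x^-1%g).
Proof.
move=> s B [u uB].
exists (map (galgV s) u) => t ts; apply: uB => x xu /=.
have [_ sK] := galgVK s; have [tK _] := galgVK t.
change (galgV t x = galgV s x).
by rewrite -[in LHS](sK x) -(ts (galgV s x)) ?tK //; exact: map_f.
Qed.

HB.instance Definition _ :=
  isTopologicalGroup.Build galoisGroup galgM_continuous galgV_continuous.

End GaloisGroup.

(* The absolute Galois group of F is [galoisGroup iota] for a separable closure
   iota : F -> L; the library constructs no such L, and L is unique up to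
   isomorphism, so statements about it quantify over every L. *)
Definition field_cd_le (F : fieldType) (n : nat) : Prop :=
  forall (L : fieldType) (iota : {rmorphism F -> L}),
    separable_closure iota -> cd_le (galoisGroup iota) n.

Definition strong_massey_conjecture (F : fieldType) (p : nat) : Prop :=
  forall (L : fieldType) (iota : {rmorphism F -> L}),
    separable_closure iota -> strong_massey_vanishing (galoisGroup iota) p.

(* Main.v *)
Require Import Defs.
From HB Require Import structures.
From mathcomp Require Import all_boot all_order all_algebra all_field.
From mathcomp Require Import generic_quotient ring_quotient ring zify.
From mathcomp Require Import boolp classical_sets functions filter.
From mathcomp Require Import topology_structure product_topology.
From mathcomp Require Import initial_topology discrete_topology function_spaces.
Set Implicit Arguments.
Unset Strict Implicit.
Unset Printing Implicit Defensive.
Import GRing.Theory.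
Local Open Scope classical_set_scope.
Local Open Scope ring_scope.

(* Write G for the Galois group of K, j for a square root of -1 in the separable
   closure, S for the stabilizer of j, which is the absolute Galois group of
   K(j), and chi for the character of G with kernel S. If z is a 2-cocycle of G
   then H^2(S) = 0 lets one normalize z to z (g, h) = [g notin S] v h. When
   S = G or p is odd this gives H^2(G) = 0, so that no obstruction occurs.
   When p = 2 and S <> G it shows that cupping with chi maps H^1 onto H^2, and
   the same argument applied to a 2-cochain bounding chi z shows that cupping
   with chi is injective on H^2. Together with x x = chi x, which comes from
   Kummer theory, this makes H^2 a Boolean ring with unit chi chi under the
   product (chi u) (chi v) = u v.

   Decompose chi in H^2 into orthogonal idempotents e_s refining the a_i. Modulo
   classes annihilated by H^1, each a_i is a sum of some of the e_s, and since
   a_i a_(i+1) = 0 no e_s occurs in both a_i and a_(i+1). By multilinearity it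
   suffices to build a compatible defining system for all the words in the
   letters e_s (and in annihilated letters) without two equal consecutive e_s.
   This goes by induction on the length: the obstructions f (w), for |w| = n, are
   classes chi v (w) and satisfy
     x_0 f (x_1 .. x_n) = f (x_0 .. x_(n-1)) x_n   in H^3.
   Multiplying by idempotents, the component e_s f (w) vanishes unless e_s is the
   first or the last letter of w, and then these relations say exactly that f is
   removed by changing the system on the words of length n - 1. *)

(** * Cochains of low degree *)

Section LowDegree.
Variables (G : topologicalGroupType) (p : nat).
Local Notation Fp := (trivialModule G 'F_p).
Local Notation "'C^ n" := (cochain Fp n) (at level 8, n at level 2).
Local Notation "'Z^ n" := (cocycle Fp n) (at level 8, n at level 2).
Local Notation "'H^ n" := (cohomology Fp n) (at level 8, n at level 2).

(* Valuing cochains in the sort of a constant of type [fieldType] lets [ring]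
   recognise the operations, which it does not on the ordinal type ['F_p]. *)
Definition FpField : fieldType := 'F_p.

Definition pt2 (g h : G) : pow G 2 := fun i => if i == ord0 then g else h.
Definition pt3 (g h k : G) : pow G 3 := fun i =>
  if i == ord0 then g else if i == ord_max then k else h.

Definition ev1 (f : 'C^1) (g : G) : FpField := f (fun=> g).
Definition ev2 (f : 'C^2) (g h : G) : FpField := f (pt2 g h).
Definition ev3 (f : 'C^3) (g h k : G) : FpField := f (pt3 g h k).

Lemma ev2_inj (f f' : 'C^2) : ev2 f =2 ev2 f' -> f = f'.
Proof.
move=> ff; apply/val_inj/funext => x /=.
have -> : x = pt2 (x ord0) (x ord_max).
  by apply/funext => -[[|[|//]] lti]; rewrite /pt2 /=; congr x; apply: val_inj.
exact: ff.
Qed.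

Lemma ev3_inj (f f' : 'C^3) : (forall g, ev3 f g =2 ev3 f' g) -> f = f'.
Proof.
move=> ff; apply/val_inj/funext => x /=.
have -> : x = pt3 (x ord0) (x (lift ord0 ord0)) (x ord_max).
  by apply/funext => -[[|[|[|//]]] lti]; rewrite /pt3 /=; congr x; apply: val_inj.
exact: ff.
Qed.

Lemma ev10 g : ev1 0 g = 0. Proof. by []. Qed.
Lemma ev20 g h : ev2 0 g h = 0. Proof. by []. Qed.
Lemma ev30 g h k : ev3 0 g h k = 0. Proof. by []. Qed.
Lemma ev1D f f' g : ev1 (f + f') g = ev1 f g + ev1 f' g. Proof. by []. Qed.
Lemma ev1N f g : ev1 (- f) g = - ev1 f g. Proof. by []. Qed.
Lemma ev2D f f' g h : ev2 (f + f') g h = ev2 f g h + ev2 f' g h.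
Proof. by []. Qed.
Lemma ev2N f g h : ev2 (- f) g h = - ev2 f g h. Proof. by []. Qed.
Lemma ev3D f f' g h k : ev3 (f + f') g h k = ev3 f g h k + ev3 f' g h k.
Proof. by []. Qed.
Lemma ev3N f g h k : ev3 (- f) g h k = - ev3 f g h k. Proof. by []. Qed.

Lemma ev2_diff (f : 'C^1) g h :
  ev2 (differential f) g h = ev1 f h - ev1 f (g * h)%g + ev1 f g.
Proof.
rewrite /ev2 /= /dfun big_ord1 expr1 mulrN1z sqrrN expr1n mulr1z /=.
by rewrite (cochain1E f (behead_pow _)) (cochain1E f (contract _ _))
  (cochain1E f (belast_pow _)).
Qed.

Lemma ev3_diff (w : 'C^2) g h k :
  ev3 (differential w) g h k =
  ev2 w h k - ev2 w (g * h)%g k + ev2 w g (h * k)%g - ev2 w g h.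
Proof.
rewrite /ev3 /= /dfun !big_ord_recl big_ord0 /= addr0.
rewrite expr1 mulrN1z sqrrN expr1n mulr1z exprS sqrrN expr1n mulr1 mulrN1z.
rewrite addrA; congr (_ - _ + _ - _); rewrite /ev2; congr (cochain_fun w _);
  by apply/funext => -[[|[|//]] lti].
Qed.

(** The ascribed types replace the degrees 1 + 1, 1 + 2 and 2 + 1 by literals. *)
Definition cup11 (f g : 'C^1) : 'C^2 := cup f g.
Definition cup12 (f : 'C^1) (g : 'C^2) : 'C^3 := cup f g.
Definition cup21 (f : 'C^2) (g : 'C^1) : 'C^3 := cup f g.

Lemma ev_cup11 f f' g h : ev2 (cup11 f f') g h = ev1 f g * ev1 f' h.
Proof.
by rewrite /ev2 /= /cup_fun (cochain1E f) (cochain1E f').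
Qed.

Lemma ev_cup12 f w g h k : ev3 (cup12 f w) g h k = ev1 f g * ev2 w h k.
Proof.
rewrite /ev3 /= /cup_fun (cochain1E f) /ev1 /ev2; congr (_ * cochain_fun w _).
by apply/funext => -[[|[|//]] lti].
Qed.

Lemma ev_cup21 w f g h k : ev3 (cup21 w f) g h k = ev2 w g h * ev1 f k.
Proof.
rewrite /ev3 /= /cup_fun (cochain1E f) /ev1 /ev2; congr (cochain_fun w _ * _).
by apply/funext => -[[|[|//]] lti].
Qed.

(* The library's [mulgA] leaves products in another, convertible, instance. *)
Lemma tmulgA (x y z : G) : (x * (y * z))%g = (x * y * z)%g.
Proof. exact: mulgA. Qed.

Definition evE := (ev2_diff, ev3_diff, ev_cup11, ev_cup12, ev_cup21,
  ev10, ev20, ev30, ev1D, ev1N, ev2D, ev2N, ev3D, ev3N).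

End LowDegree.

(* [ring] only succeeds once the cochain values are generalized and the
   context is cleared. *)
Ltac ring_ev := rewrite ?evE; repeat match goal with
  | |- context [ev1 ?f ?x] => generalize (ev1 f x); intro
  | |- context [ev2 ?f ?x ?y] => generalize (ev2 f x y); intro end; clear; ring.

Section Cup.
Variables (G : topologicalGroupType) (p : nat).
Local Notation Fp := (trivialModule G 'F_p).
Local Notation "'C^ n" := (cochain Fp n) (at level 8, n at level 2).
Local Notation "'Z^ n" := (cocycle Fp n) (at level 8, n at level 2).
Local Notation "'H^ n" := (cohomology Fp n) (at level 8, n at level 2).

Lemma cup11_is_additivel (f : 'C^1) : zmod_morphism (cup11 f).
Proof. by move=> a b; apply: ev2_inj => g h; ring_ev. Qed.
HB.instance Definition _ f := GRing.isZmodMorphism.Build 'C^1 'C^2 (cup11 f)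
  (cup11_is_additivel f).

Lemma cup11Dl (f f' g : 'C^1) : cup11 (f + f') g = cup11 f g + cup11 f' g.
Proof. apply: ev2_inj => x y. ring_ev. Qed.

Lemma cup12_sumr I (r : seq I) (P : pred I) (F : I -> 'C^2) g :
  cup12 g (\sum_(i <- r | P i) F i) = \sum_(i <- r | P i) cup12 g (F i).
Proof.
have cup0 : cup12 g 0 = 0 by apply: ev3_inj => x y z; rewrite !evE mulr0.
have cupD : {morph (cup12 g) : f f' / f + f'}.
  by move=> f f'; apply: ev3_inj => x y z; rewrite !evE mulrDr.
exact: (big_morph (cup12 g) cupD cup0).
Qed.

Lemma cup21_suml I (r : seq I) (P : pred I) (F : I -> 'C^2) g :
  cup21 (\sum_(i <- r | P i) F i) g = \sum_(i <- r | P i) cup21 (F i) g.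
Proof.
have cup0 : cup21 0 g = 0 by apply: ev3_inj => x y z; rewrite !evE mul0r.
have cupD : {morph (fun f => cup21 f g) : f f' / f + f'}.
  by move=> f f'; apply: ev3_inj => x y z; rewrite !evE mulrDl.
exact: (big_morph (fun f => cup21 f g) cupD cup0).
Qed.

Lemma cup11A (f g h : 'C^1) : cup21 (cup11 f g) h = cup12 f (cup11 g h).
Proof. by apply: ev3_inj => x y z; rewrite !evE mulrA. Qed.

Lemma differential_cup11 (f g : 'C^1) :
  differential (cup11 f g) = cup21 (differential f) g - cup12 f (differential g).
Proof. apply: ev3_inj => x y z. ring_ev. Qed.

Lemma differentialK (f : 'C^1) : differential (differential f) = 0.
Proof. apply: ev3_inj => x y z; rewrite !evE tmulgA. ring_ev. Qed.

Lemma differentialB_diff (w : 'C^2) (f : 'C^1) :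
  differential (w - differential f) = differential w.
Proof. apply: ev3_inj => x y z; rewrite !evE tmulgA. ring_ev. Qed.

Lemma ev1_near (f : 'C^1) (x : G) : \forall y \near x, ev1 f y = ev1 f x.
Proof.
apply: (@cochain_near _ Fp G 1 f (fun y => fun=> y)).
by apply: pow_continuous => j y; apply: cvg_id.
Qed.

Lemma ev2_near (w : 'C^2) (T : topologicalType) (u v : T -> G) (x : T) :
  continuous u -> continuous v ->
  \forall y \near x, ev2 w (u y) (v y) = ev2 w (u x) (v x).
Proof.
move=> uC vC; apply: (@cochain_near _ Fp T 2 w (fun y => pt2 (u y) (v y))).
by apply: pow_continuous => j; rewrite /pt2; case: (j == ord0).
Qed.

Fact mk1_continuous (f : G -> FpField p) :
  (forall x, \forall y \near x, f y = f x) ->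
  (fun x : pow G 1 => f (x ord0)) \in @continuous_pred G Fp 1.
Proof.
move=> fC; apply/continuous_predP => x.
exact: (@coord_continuous G 1 ord0 x _ (fC (x ord0))).
Qed.

Definition mk1 (f : G -> FpField p) (fC : forall x, \forall y \near x, f y = f x) :
  'C^1 := Cochain (mk1_continuous fC).

Lemma ev_mk1 f fC : ev1 (@mk1 f fC) =1 f. Proof. by []. Qed.

Fact cohomology_class_is_additive n :
  zmod_morphism (@cohomology_class G Fp n).
Proof. exact: pi_is_zmod_morphism. Qed.
HB.instance Definition _ n := GRing.isZmodMorphism.Build 'Z^ n 'H^ n
  (@cohomology_class G Fp n) (@cohomology_class_is_additive n).

Lemma cohomology_class_eq0 n (z : 'Z^ n) :
  cohomology_class z = 0 <-> is_coboundary (z : 'C^ n).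
Proof.
have -> : 0 = cohomology_class (0 : 'Z^ n) by rewrite raddf0.
by rewrite cohomology_classP subr0.
Qed.

Lemma cocycle_diff n (z : 'Z^ n) : differential z = 0.
Proof. exact: (eqP (cocycleP z)). Qed.

Lemma cocycle1P (f : 'C^1) :
  (forall g h, ev1 f (g * h)%g = ev1 f g + ev1 f h) <->
  differential f = 0.
Proof.
split=> [fM|df g h].
  apply: ev2_inj => g h; rewrite !evE fM. ring_ev.
by have /(congr1 (fun w => ev2 w g h)) := df; rewrite !evE => /eqP;
  rewrite addrAC subr_eq0 addrC => /eqP.
Qed.

Lemma cohomology_class_surj n (c : 'H^ n) :
  exists z : 'Z^ n, c = cohomology_class z.
Proof. by exists (repr c); rewrite /cohomology_class reprK. Qed.

End Cup.

(** * Subgroups of index two without second cohomology *)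

Lemma addFp2 p (x : FpField p) : p = 2%N -> x + x = 0.
Proof. by move=> p2; subst p; apply: (@addrr_pchar2 'F_2); rewrite pchar_Fp. Qed.

Lemma oppFp2 p (x : FpField p) : p = 2%N -> - x = x.
Proof. by move=> p2; apply/eqP; rewrite eq_sym -addr_eq0 addFp2. Qed.

Section IndexTwo.
Variables (G : topologicalGroupType) (p : nat).
Local Notation Fp := (trivialModule G 'F_p).
Local Notation "'C^ n" := (cochain Fp n) (at level 8, n at level 2).
Local Notation "'Z^ n" := (cocycle Fp n) (at level 8, n at level 2).
Local Notation "'H^ n" := (cohomology Fp n) (at level 8, n at level 2).

Variable S : pred G.
(** This says that [S] is the kernel of a homomorphism to a group of order two, and [S_near] that it
    is open. *)
Hypothesis SM : forall g h, S (g * h)%g = (S g == S h).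
Hypothesis S_near : forall x, \forall y \near x, S y = S x.
(** H^2(S) = 0, read on cochains of [G]: [b] is locally constant on all of [G] but bounds [w] only
    on [S]. *)
Hypothesis S_acyclic : forall w : 'C^2,
  (forall g h k, S g -> S h -> S k -> ev3 (differential w) g h k = 0) ->
  exists2 b : G -> FpField p, (forall x, \forall y \near x, b y = b x) &
    forall g h, S g -> S h -> ev2 w g h = b h - b (g * h)%g + b g.

Let S1 : S 1%g. Proof. by have := SM 1 1; rewrite mul1g eqxx. Qed.
Let SV g : S g^-1%g = S g.
Proof. by have := SM g g^-1%g; rewrite mulgV S1 => /esym/eqP. Qed.

Lemma H2_eq0_full (z : 'C^2) : (forall g, S g) -> differential z = 0 ->
  exists y : 'C^1, z = differential y.
Proof.
move=> ST dz; have [g h k _ _ _|b bC bE] := S_acyclic (w := z).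
  by rewrite dz.
by exists (mk1 bC); apply: ev2_inj => g h; rewrite evE !ev_mk1 bE.
Qed.

Variable tau : G.
Hypothesis tauS : ~~ S tau.

(* A 2-cochain [b] on [S] bounding [w] there extends to the other coset by
   solving [d b (h, tau) = w (h, tau)]; the corrected [w] vanishes on [S x G],
   so depends on its first argument only through its coset. *)
Lemma cochain2_normal_form (w : 'C^2) :
  (forall h g k, S h -> ev3 (differential w) h g k = 0) ->
  exists b y : 'C^1, forall g k,
    ev2 (w - differential b) g k = if S g then 0 else ev1 y k.
Proof.
move=> dw; have [g h k Sg _ _|b bC bE] := S_acyclic (w := w); first exact: dw.
pose b' g := if S g then b g else b (g * tau^-1)%g - ev2 w (g * tau^-1)%g tau.
have b'C x : \forall y \near x, b' y = b' x.
  have tC : continuous (fun y => y * tau^-1 : G)%g.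
    move=> u; apply: (@continuous2_cvg G G G G (nbhs u) _ id (fun=> tau^-1)%g
      (fun a b => (a * b)%g)); [|exact: cvg_id|exact: cvg_cst].
    exact: (@mulg_continuous G (u, tau^-1%g)).
  near=> y; rewrite /b'.
  have -> : S y = S x by near: y; exact: S_near.
  have -> : b y = b x by near: y; exact: bC.
  have -> : b (y * tau^-1)%g = b (x * tau^-1)%g by near: y; exact: (tC x _ (bC _)).
  have -> // : ev2 w (y * tau^-1)%g tau = ev2 w (x * tau^-1)%g tau.
  by near: y; apply: (@ev2_near _ _ w G (fun y => y * tau^-1)%g (fun=> tau)) => // u;
    exact: cvg_cst.
pose w' := w - differential (mk1 b'C).
have dw' h g k : S h ->
    ev2 w' g k - ev2 w' (h * g)%g k + ev2 w' h (g * k)%g - ev2 w' h g = 0.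
  by move=> Sh; rewrite -ev3_diff differentialB_diff; exact: dw.
have w'SS g h : S g -> S h -> ev2 w' g h = 0.
  move=> Sg Sh; rewrite /w' !evE !ev_mk1 bE // /b' Sg Sh SM Sg Sh eqxx.
  by rewrite subrr.
have w'St h : S h -> ev2 w' h tau = 0.
  (* The identity at 1, 1, [tau] gives w(1, tau) = w(1, 1) = b(1). *)
  have w1t : ev2 w 1%g tau = b 1%g.
    have := dw 1%g 1%g tau S1; rewrite evE !mul1g subrr add0r.
    by move/eqP; rewrite subr_eq0 (bE 1%g 1%g) // mul1g subrr add0r => /eqP.
  move=> Sh; rewrite /w' !evE !ev_mk1 /b' Sh SM Sh (negPf tauS) /=.
  by rewrite mulgV -tmulgA mulgV mulg1 w1t subrr sub0r opprB subrK subrr.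
have w'S h g : S h -> ev2 w' h g = 0.
  move=> Sh; have [Sg|Sg] := boolP (S g); first exact: w'SS.
  (* With [g] written as an element of [S] times [tau], the identity at [h], [g * tau^-1], [tau]
     reduces to the two previous cases. *)
  have Sgt : S (g * tau^-1)%g by rewrite SM SV (negPf Sg) (negPf tauS).
  have := dw' h (g * tau^-1)%g tau Sh.
  have Shgt : S (h * (g * tau^-1))%g by rewrite SM Sh Sgt.
  rewrite (w'St _ Sgt) (w'St _ Shgt).
  rewrite (w'SS _ _ Sh Sgt) -tmulgA mulVg mulg1.
  by rewrite subrr add0r subr0.
exists (mk1 b'C).
(* Take y = w'(tau, -): since [w'] vanishes on S x G, the identity at [g * tau^-1], [tau], [k] gives
   w'(g, k) = w'(tau, k) for [g] outside [S]. *)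
have yC x : \forall y \near x, ev2 w' tau y = ev2 w' tau x.
  by apply: (@ev2_near _ _ w' G (fun=> tau) id) => u;
    [exact: cvg_cst|exact: cvg_id].
exists (mk1 yC) => g k; rewrite -/w'; have [Sg|Sg] := ifPn; first exact: w'S.
have Sgt : S (g * tau^-1)%g by rewrite SM SV (negPf Sg) (negPf tauS).
rewrite ev_mk1; have := dw' _ tau k Sgt; rewrite !(w'S (g * tau^-1)%g) //.
rewrite -tmulgA mulVg mulg1 subr0 addr0 => /eqP; rewrite subr_eq0.
by move=> /eqP.
Unshelve. all: by end_near. Qed.

(** The cocycle identity at [tau], [g], [k] makes [y] a crossed homomorphism for the sign character
    with kernel [S]. *)
Lemma cocycle2_normal_form (z : 'C^2) : differential z = 0 ->
  exists b y : 'C^1,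
    (forall g k, ev2 (z - differential b) g k = if S g then 0 else ev1 y k) /\
    (forall g k, ev1 y (g * k)%g = ev1 y g + if S g then ev1 y k else - ev1 y k).
Proof.
move=> dz; have [h g k _|b [y zE]] := @cochain2_normal_form z; first by rewrite dz.
exists b, y; split=> // g k.
have : ev3 (differential (z - differential b)) tau g k = 0.
  by rewrite differentialB_diff dz.
rewrite ev3_diff !zE (negPf tauS) SM (negPf tauS) /=; case: (S g) => /=.
  rewrite sub0r => /eqP; rewrite subr_eq0 addrC subr_eq => /eqP->.
  by [].
rewrite subr0 => /eqP; rewrite subr_eq0 addrC => /eqP <-.
by rewrite addrK.
Qed.

(** The coboundary of v / 2 at (g, k) is 0 for [g] in [S] and v(k) otherwise, because [v] is a
    crossed homomorphism; this is the normal form of [z]. *)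
Lemma H2_eq0_odd (z : 'C^2) : (2%:R : FpField p) != 0 -> differential z = 0 ->
  exists y : 'C^1, z = differential y.
Proof.
move=> p2 dz; have [b [v [zE vM]]] := cocycle2_normal_form dz.
have vC x : \forall y \near x, ev1 v y / 2%:R = ev1 v x / 2%:R.
  by near=> y; have -> // : ev1 v y = ev1 v x; near: y; exact: ev1_near.
exists (mk1 vC + b); rewrite raddfD /=; apply/eqP; rewrite -subr_eq; apply/eqP.
apply: ev2_inj => g k; rewrite zE evE !ev_mk1 vM.
have /= half : ev1 v k = ev1 v k / 2%:R + ev1 v k / 2%:R.
  by rewrite -mulrDl -mulr2n -[_ *+ 2]mulr_natr mulfK.
case: (S g); last rewrite {1}half; move: (2%:R^-1) => c; ring_ev.
Unshelve. all: by end_near. Qed.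

Hypothesis p2 : p = 2%N.

Fact chi_near x : \forall y \near x,
  (if S y then 0 else 1 : FpField p) = if S x then 0 else 1.
Proof. by near=> y; have -> // : S y = S x; near: y; exact: S_near.
Unshelve. all: by end_near. Qed.

Definition chi : 'C^1 := mk1 chi_near.

Lemma chi_cocycle : differential chi = 0.
Proof.
apply/cocycle1P => g h; rewrite !ev_mk1 SM.
by case: (S g); case: (S h); rewrite /= ?addr0 ?add0r ?(addFp2 _ p2).
Qed.

(** Modulo 2 the sign disappears: the crossed homomorphism is a character [v], and the normal form
    is the cup product of [chi] and [v]. *)
Lemma cup_chi_surj (z : 'C^2) : differential z = 0 ->
  exists b v : 'C^1, differential v = 0 /\ z = cup11 chi v + differential b.
Proof.
move=> dz; have [b [v [zE vM]]] := cocycle2_normal_form dz.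
exists b, v; split.
  by apply/cocycle1P => g k; rewrite vM (oppFp2 _ p2) if_same.
apply/eqP; rewrite -subr_eq; apply/eqP/ev2_inj => g k.
by rewrite zE evE ev_mk1; case: (S g); rewrite ?mul0r ?mul1r.
Qed.

(* If [d w = chi z] then [d w] vanishes on [S x G x G], and the normal form
   of [w] exhibits [z] as a coboundary. *)
Lemma cup_chi_inj (z w : 'C^2) : differential w = cup12 chi z ->
  exists y : 'C^1, z = differential y.
Proof.
move=> dw; have [h g k Sh|b [y wE]] := @cochain2_normal_form w.
  by rewrite dw evE ev_mk1 Sh mul0r.
exists y; apply: ev2_inj => g k; rewrite evE.
have : ev3 (differential (w - differential b)) tau g k = ev2 z g k.
  by rewrite differentialB_diff dw evE ev_mk1 (negPf tauS) mul1r.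
rewrite ev3_diff !wE (negPf tauS) SM (negPf tauS) /= => <-.
by case: (S g) => /=; rewrite !(oppFp2 _ p2) ?add0r ?addr0.
Qed.

End IndexTwo.

(** * Galois groups *)

Section SeparablyClosed.
Variables (K L : fieldType) (iota : {rmorphism K -> L}).
Hypothesis sepL : separable_closure iota.

Lemma sqrt_exists (a : L) : (2%:R : L) != 0 -> exists b : L, b ^+ 2 = a.
Proof.
move=> L2; have [->|a0] := eqVneq a 0; first by exists 0; rewrite expr0n.
have sz : size ('X^2 - a%:P) = 3%N by rewrite size_XnsubC.
have [||b] := sepL.2 ('X^2 - a%:P); last 2 first.
- by rewrite sz.
- by rewrite rootE !hornerE subr_eq0 => /eqP; exists b.
rewrite unlock derivB derivC subr0 derivXn /= expr1.
(* A Bezout relation between X^2 - a and its derivative 2X. *)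
apply/Bezout_coprimepP; exists (- (a^-1)%:P, (a^-1 / 2%:R) *: 'X) => /=.
suff -> : - (a^-1)%:P * ('X^2 - a%:P) + (a^-1 / 2%:R) *: 'X * ('X *+ 2) = 1.
  exact: eqpxx.
have aV : (a^-1)%:P * a%:P = 1 :> {poly L} by rewrite -polyCM mulVf.
have hV : (2%:R^-1)%:P * 2%:R = 1 :> {poly L}.
  by rewrite -polyC_natr -polyCM mulVf.
transitivity ((a^-1)%:P * a%:P + (a^-1)%:P * 'X^2 * ((2%:R^-1)%:P * 2%:R - 1)).
  by rewrite -mul_polyC polyCM; ring.
by rewrite aV hV subrr mulr0 addr0.
Qed.

Lemma root_seq (q : {poly L}) : q != 0 ->
  exists rs : seq L, forall x, root q x -> x \in rs.
Proof.
have [m] := ubnP (size q); elim: m q => // m IHm q; rewrite ltnS => szq q0.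
have [[z qz]|noz] := pselect (exists z, root q z); last first.
  by exists [::] => x qx; case: noz; exists x.
have [q' qE] := factor_theorem q z qz.
have q'0 : q' != 0 by apply: contraNneq q0 => q'0; rewrite qE q'0 mul0r.
have [|rs rsP] := IHm q' _ q'0.
  by move: szq; rewrite qE size_Mmonic ?monicXsubC // size_XsubC addn2 /=.
exists (z :: rs) => x; rewrite qE rootM root_XsubC inE => /orP[/rsP->|->] //.
by rewrite orbT.
Qed.

End SeparablyClosed.

(** * Embedding K(i) into the separable closure *)

Section AdjoinI.
Variables (K : fieldType) (Ki : fieldExtType K) (i : Ki).
Hypotheses (hi : i ^+ 2 = -1) (hKi : <<1%AS; i>>%VS = {:Ki}%VS).
Variables (L : fieldType) (iota : {rmorphism K -> L}).
Hypothesis sepL : separable_closure iota.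

Let ev (q : {poly K}) : Ki := (map_poly (in_alg Ki) q).[i].

Let ev_surj y : exists q, ev q = y.
Proof.
have : y \in <<1%AS; i>>%VS by rewrite hKi memvf.
by move=> /Fadjoin_polyP[_ /polyOver1P[q ->] ->]; exists q.
Qed.

(** The second condition makes evaluation at [j] factor through evaluation at [i]. If [i] lies in K,
    its image serves as [j]; otherwise any square root of -1 does, since a polynomial vanishing at
    [i] has zero remainder modulo X^2 + 1. *)
Let j_exists : exists2 j : L, j ^+ 2 = -1 &
  forall q, ev q = 0 -> (map_poly iota q).[j] = 0.
Proof.
have [[c ic]|iK] := pselect (exists c : K, i = c%:A).
  have alg_inj := fmorph_inj (in_alg Ki).
  exists (iota c) => [|q].
    rewrite -rmorphXn /=; have -> : c ^+ 2 = -1; last by rewrite rmorphN1.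
    by apply: alg_inj; rewrite rmorphXn rmorphN1 /= -ic.
  rewrite /ev ic horner_map /= -[0](rmorph0 (in_alg Ki)) => /alg_inj qc.
  by rewrite horner_map /= qc rmorph0.
have K2 : (2%:R : K) != 0.
  (* In characteristic two (i - 1)^2 = 0, so i = 1 would lie in K. *)
  apply/eqP => K2; case: iK; exists 1; rewrite scale1r.
  have Ki2 : 2%:R = 0 :> Ki by rewrite -(rmorph_nat (in_alg Ki)) K2 rmorph0.
  have /eqP : (i - 1) ^+ 2 = 0.
    rewrite (_ : (i - 1) ^+ 2 = i ^+ 2 + 1 - 2%:R * i); last by ring.
    by rewrite hi Ki2 addNr mul0r subr0.
  by rewrite expf_eq0 /= subr_eq0 => /eqP.
have [|j jE] := sqrt_exists sepL (-1).
  by rewrite -(rmorph_nat iota) fmorph_eq0.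
exists j => // q.
have sz2 : size ('X^2 + 1 : {poly K}) = 3%N.
  by rewrite size_polyDl ?size_polyXn ?size_poly1.
rewrite /ev (divp_eq q ('X^2 + 1)) !rmorphD !rmorphM /= !rmorphD /=.
rewrite !map_polyXn !rmorph1.
rewrite !hornerE hi jE !addNr !mulr0 !add0r.
set r := (q %% _).
have szr : (size r <= 2)%N by rewrite -ltnS -sz2 ltn_modp -size_poly_eq0 sz2.
have rE : r = (r`_0)%:P + r`_1 *: 'X.
  apply/polyP => -[|[|k]]; rewrite !coefE /= ?mulr0 ?mulr1 ?addr0 ?add0r //.
  by rewrite nth_default // (leq_trans szr).
rewrite rE !rmorphD /= !map_polyC !map_polyZ !map_polyX !hornerE /=.
have [->|r1] := eqVneq r`_1 0.
  rewrite rmorph0 mul0r addr0 => r0; have : in_alg Ki r`_0 == 0.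
    by rewrite -[X in _ == X]r0 /= scale0r mul0r addr0.
  rewrite fmorph_eq0 => /eqP ->. by rewrite rmorph0.
move=> rE0; case: iK; exists (- r`_0 / r`_1).
have r1' : in_alg Ki r`_1 != 0 by rewrite fmorph_eq0.
apply: (mulfI r1'); move: rE0 => /eqP; rewrite addrC addr_eq0 => /eqP ->.
by rewrite -[_%:A]/(in_alg Ki _) -rmorphM -rmorphN mulrCA divff // mulr1.
Qed.

(** The embedding sends q(i) to q(j). An automorphism over K that fixes [j] fixes every q(j), so the
    Galois group over K(i) is the stabilizer of [j]. *)
Lemma extend_to_adjoin_i : exists (iota' : {rmorphism Ki -> L}) (j : L),
  [/\ j ^+ 2 = -1, forall c, iota' c%:A = iota c &
      forall s : L -> L, is_galg iota' s <-> is_galg iota s /\ s j = j].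
Proof.
have [j jE evj] := j_exists.
pose f y := (map_poly iota (projT1 (cid (ev_surj y)))).[j].
have fE q y : ev q = y -> f y = (map_poly iota q).[j].
  move=> qy; rewrite /f; case: cid => q' /= q'y; apply/eqP.
  rewrite -subr_eq0 -hornerN -hornerD -rmorphN -rmorphD; apply/eqP/evj.
  by rewrite /ev rmorphB hornerD hornerN -/(ev q) -/(ev q') qy q'y subrr.
have fB : zmod_morphism f.
  move=> y z; have [q qy] := ev_surj y; have [r rz] := ev_surj z.
  rewrite (fE q y) // (fE r z) // (fE (q - r)) ?rmorphB ?hornerD ?hornerN //.
  by rewrite /ev rmorphB hornerD hornerN -/(ev q) -/(ev r) qy rz.
have f1 : f 1 = 1.
  by rewrite (fE 1) ?rmorph1 ?hornerC // /ev rmorph1 hornerC.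
have fM : {morph f : y z / y * z}.
  move=> y z; have [q qy] := ev_surj y; have [r rz] := ev_surj z.
  rewrite (fE q y) // (fE r z) // (fE (q * r)) ?rmorphM ?hornerM //.
  by rewrite /ev rmorphM hornerM -/(ev q) -/(ev r) qy rz.
pose f' : {rmorphism Ki -> L} := HB.pack f
  (GRing.isZmodMorphism.Build _ _ f fB)
  (GRing.isMonoidMorphism.Build _ _ f (f1, fM)).
have fA c : f c%:A = iota c.
  by rewrite (fE c%:P) ?map_polyC ?hornerC // /ev map_polyC hornerC.
exists f', j; split=> // s; split=> [[sB sM sbij sf]|[[sB sM sbij sK] sj]].
  split; first by split=> // c; rewrite -fA sf.
  have <- : f i = j.
    by rewrite (fE 'X) ?map_polyX ?hornerX // /ev map_polyX hornerX.
  exact: sf.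
split=> // y; have [q qy] := ev_surj y; rewrite /= (fE q y) //.
pose s' : {rmorphism L -> L} := HB.pack s
  (GRing.isZmodMorphism.Build _ _ s sB)
  (GRing.isMonoidMorphism.Build _ _ s sM).
rewrite -[s _]/(s' _) -horner_map [s' j]sj -map_poly_comp.
by congr (_.[_]); apply: eq_map_poly => c /=.
Qed.

Lemma separable_closure_extend (iota' : {rmorphism Ki -> L}) :
  (forall c, iota' c%:A = iota c) -> separable_closure iota'.
Proof.
move=> iotaE; split; last exact: sepL.2.
move=> x; have [q sq qx] := sepL.1 x; exists (map_poly (in_alg Ki) q).
  by rewrite separable_map.
by rewrite -map_poly_comp (eq_map_poly (g := iota)).
Qed.

End AdjoinI.

(** * The stabilizer of a square root of -1 *)

Section FixedByI.
Variables (K M L : fieldType) (iota : {rmorphism K -> L}).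
Variables (iota' : {rmorphism M -> L}) (j : L).
Hypothesis jE : j ^+ 2 = -1.
Hypothesis galgE : forall s : L -> L,
  is_galg iota' s <-> is_galg iota s /\ s j = j.
Local Notation G := (galoisGroup iota).
Local Notation H := (galoisGroup iota').

Section Automorphisms.
Variables (k : fieldType) (kL : {rmorphism k -> L}) (g : galoisGroup kL).
Lemma galgB x y : g (x - y) = g x - g y.
Proof. by have [gB _ _ _] := asboolP _ (galgP g); exact: gB. Qed.
Lemma galg_mul x y : g (x * y) = g x * g y.
Proof. by have [_ [_ gM] _ _] := asboolP _ (galgP g); exact: gM. Qed.
Lemma galg_one : g 1 = 1.
Proof. by have [_ [g1 _] _ _] := asboolP _ (galgP g). Qed.
Lemma galg0 : g 0 = 0.
Proof. by have := galgB 0 0; rewrite !subrr. Qed.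
Lemma galgN x : g (- x) = - g x.
Proof. by rewrite -sub0r galgB galg0 sub0r. Qed.
Lemma galgD x y : g (x + y) = g x + g y.
Proof. by rewrite -[y in LHS]opprK galgB galgN opprK. Qed.
Lemma galgX x n : g (x ^+ n) = g x ^+ n.
Proof.
by elim: n => [|n IHn]; rewrite ?expr0 ?galg_one // !exprS galg_mul IHn.
Qed.
Lemma galg_inj : injective g.
Proof. by have [_ _ /bij_inj gI _] := asboolP _ (galgP g). Qed.
Lemma galg_base c : g (kL c) = kL c.
Proof. by have [_ _ _ gK] := asboolP _ (galgP g). Qed.
End Automorphisms.

Definition fixes_i : pred G := fun g => g j == j.

Lemma galg_i (g : G) : g j = if fixes_i g then j else - j.
Proof.
rewrite /fixes_i; case: eqP => // gj; apply/eqP.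
have : g j ^+ 2 == j ^+ 2 by rewrite -galgX jE galgN galg_one.
by rewrite eqf_sqr => /orP[/eqP|].
Qed.

Lemma fixes_iM (g h : G) : fixes_i (g * h)%g = (fixes_i g == fixes_i h).
Proof.
have -> : fixes_i (g * h)%g = (g (h j) == j) by [].
rewrite (galg_i h); have [Sh|Sh] := boolP (fixes_i h).
  by rewrite eqb_id.
rewrite galgN galg_i; have [Sg|Sg] := boolP (fixes_i g).
  by move: (Sh); rewrite {1}/fixes_i galg_i (negPf Sh) => /negPf.
by rewrite opprK eqxx.
Qed.

Lemma fixes_i_near (g : G) : \forall h \near g, fixes_i h = fixes_i g.
Proof. by exists [:: j] => h hg; rewrite /fixes_i hg // inE. Qed.

Fact embed_subproof (t : H) : `[< is_galg iota t >].
Proof. by apply/asboolP; case: (galgE t).1 => //; apply/asboolP/galgP. Qed.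

Definition embed (t : H) : G := GaloisAut (embed_subproof t).

Lemma embedM s t : embed (s * t)%g = (embed s * embed t)%g.
Proof. exact: val_inj. Qed.

Lemma embed_fixes t : fixes_i (embed t).
Proof. by apply/eqP; case: (galgE t).1 => //; apply/asboolP/galgP. Qed.

Lemma embed_continuous : continuous embed.
Proof. by move=> t B [u uB]; exists u => s st; apply: uB. Qed.

(** Automorphisms that move [j] get the default value 1. *)
Definition restrict (g : G) : H := insubd (1%g : H) (g : L -> L).

Lemma restrictK (g : G) : fixes_i g -> restrict g =1 g.
Proof.
move=> /eqP gj x; congr (_ x); rewrite -/(val (restrict g)) val_insubd.
by case: asboolP => // -[]; apply/galgE; split=> //; apply/asboolP/galgP.
Qed.

Lemma restrictM (g h : G) : fixes_i g -> fixes_i h ->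
  restrict (g * h)%g = (restrict g * restrict h)%g.
Proof.
move=> Sg Sh; apply/val_inj/funext => x.
have Sgh : fixes_i (g * h)%g by rewrite fixes_iM Sg Sh.
rewrite [LHS](restrictK Sgh) -[RHS]/(restrict g (restrict h x)).
by rewrite !restrictK.
Qed.

Lemma embedK (g : G) : fixes_i g -> embed (restrict g) = g.
Proof. by move=> Sg; apply/val_inj/funext => x; exact: restrictK. Qed.

Lemma restrict_near (g : G) (B : set H) : fixes_i g -> nbhs (restrict g) B ->
  \forall h \near g, B (restrict h).
Proof.
move=> Sg [u uB]; exists (j :: u) => h hg; apply: uB => x xu.
have Sh : fixes_i h by rewrite /fixes_i hg ?mem_head.
by rewrite !restrictK // hg // inE xu orbT.
Qed.

Variable p : nat.
Hypotheses (p_prime : prime p) (cdH : cd_le H 1).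

(** H^2 with coefficients in F_p is killed by p, so it equals its p-primary part, which is trivial
    by the bound on cd. *)
Lemma H2_eq0_cd (z : cocycle (trivialModule H 'F_p) 2) :
  is_coboundary (z : cochain _ 2).
Proof.
have mulp (a : 'F_p) : a *+ p = 0 by rewrite -mulr_natr pchar_Fp_0 ?mulr0.
apply/cohomology_class_eq0.
have torF : torsion (trivialModule H 'F_p).
  by move=> a; exists p; [exact: prime_gt0 | exact: mulp].
have := cdH p_prime torF (isT : 1 < 2)%N.
move=> /(congr1 (fun A => A (cohomology_class z))) /= zE.
suff : p_primary_part p (cohomology_class z) by rewrite zE.
exists 1%N; rewrite expn1 -raddfMn /= -[RHS](raddf0 (@cohomology_class _ _ 2)).
congr cohomology_class; apply/val_inj; rewrite raddfMn /=; apply: ev2_inj => g h.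
have evMn n : ev2 ((z : cochain _ 2) *+ n) g h = ev2 z g h *+ n.
  by elim: n => [|n IHn]; rewrite ?mulr0n // !mulrS -IHn.
by rewrite evMn; exact: mulp.
Qed.

(** The cochain is pulled back to [H] and bounded there; the bounding function, extended by 0, stays
    locally constant because the stabilizer is open and closed. *)
Lemma fixes_i_acyclic (w : cochain (trivialModule G 'F_p) 2) :
  (forall g h k, fixes_i g -> fixes_i h -> fixes_i k ->
     ev3 (differential w) g h k = 0) ->
  exists2 b : G -> FpField p, (forall x, \forall y \near x, b y = b x) &
    forall g h, fixes_i g -> fixes_i h -> ev2 w g h = b h - b (g * h)%g + b g.
Proof.
move=> dw.
have wC : (fun x : pow H 2 => w (fun i => embed (x i)))
    \in @continuous_pred H (trivialModule H 'F_p) 2.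
  apply/continuous_predP => x.
  apply: (@cochain_near _ _ (pow H 2) 2 w (fun x i => embed (x i))).
  apply: pow_continuous => i y.
  exact: (cvg_comp _ _ (@coord_continuous H 2 i y) (@embed_continuous _)).
pose wH : cochain (trivialModule H 'F_p) 2 := Cochain wC.
have wHE s t : ev2 wH s t = ev2 w (embed s) (embed t).
  by rewrite /ev2 /=; congr (cochain_fun w _); apply/funext => i;
    rewrite /pt2; case: ifP.
have wHZ : wH \in @cocycle_pred _ _ 2.
  apply/eqP/ev3_inj => s t u.
  have := dw _ _ _ (embed_fixes s) (embed_fixes t) (embed_fixes u).
  by rewrite !evE !wHE !embedM.
have [b bE] := H2_eq0_cd (Cocycle wHZ).
exists (fun g => if fixes_i g then ev1 b (restrict g) else 0) => [x|g h Sg Sh].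
  have [Sx|Sx] := boolP (fixes_i x).
    near=> y; have -> : fixes_i y.
      by rewrite (_ : fixes_i y = true) // -Sx; near: y; exact: fixes_i_near.
    near: y; apply: (restrict_near Sx (B := fun t => ev1 b t = ev1 b (restrict x))).
    exact: ev1_near.
  near=> y; have -> // : fixes_i y = false.
  by rewrite -(negPf Sx); near: y; exact: fixes_i_near.
rewrite Sg Sh fixes_iM Sg Sh eqxx restrictM // -ev2_diff -bE wHE !embedK //.
Unshelve. all: by end_near. Qed.

End FixedByI.

(** * Kummer theory of quadratic characters *)

Section Kummer.
Variables (K L : fieldType) (iota : {rmorphism K -> L}).
Hypothesis sepL : separable_closure iota.
Local Notation G := (galoisGroup iota).

Let onseq (u : seq L) (g : G) : seq L := map g u.

Let onseqP (u : seq L) (g h : G) : onseq u g = onseq u h <-> {in u, g =1 h}.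
Proof. by split=> /eq_in_map. Qed.

(** The conjugates of an element of L are among the finitely many roots of one polynomial over K. *)
Lemma galg_finite (u : seq L) :
  exists V : seq (seq L), forall g : G, onseq u g \in V.
Proof.
elim: u => [|x u [V VP]]; first by exists [:: [::]] => g; rewrite inE.
have [q sq qx] := sepL.1 x.
have [|rs rsP] := @root_seq _ (map_poly iota q).
  by rewrite map_poly_eq0 separable_poly_neq0.
exists [seq y :: v | y <- rs, v <- V] => g; apply: allpairs_f; last exact: VP.
apply: rsP; apply/rootP; rewrite -[RHS](galg0 g) -(rootP qx).
rewrite !horner_coef; rewrite (big_morph g (galgD g) (galg0 g)).
by apply: eq_bigr => k _; rewrite galg_mul galgX coef_map /= galg_base.
Qed.

(* Dedekind's independence of the characters [s] of the monoid [M]. *)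
Lemma galg_independent (M : L -> Prop) (u : seq L) (l : seq (L * G)) :
  M 1 -> (forall x y, M x -> M y -> M (x * y)) -> (forall x, x \in u -> M x) ->
  all (fun cs => cs.1 != 0) l -> uniq [seq onseq u cs.2 | cs <- l] ->
  (0 < size l)%N ->
  exists2 x, M x & \sum_(cs <- l) cs.1 * galg_fun cs.2 x != 0.
Proof.
move=> M1 MM Mu; have [n] := ubnP (size l); elim: n l => // n IHn [//|[c0 s0] l].
rewrite ltnS /= => szl /andP[c00 lc] /andP[s0l lu] _.
case: l => [|[c1 s1] l] in szl lc s0l lu *.
  by exists 1 => //; rewrite big_seq1 /= galg_one mulr1.
have [v vu vs] : exists2 v, v \in u & s1 v != s0 v.
  apply: contrapT => nv; move: s0l; rewrite inE negb_or => /andP[/eqP[]].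
  apply/onseqP => v vu; apply/eqP; rewrite eq_sym.
  by apply: contrapT => /negP vs; case: nv; exists v.
set l1 := _ :: l in szl lc s0l lu *.
(* The sum at [v * x] minus [s0 v] times the sum at [x] loses the [s0] term and keeps the [s1] term.
   Where it is nonzero, one of the two sums is nonzero. *)
pose l2 := [seq (cs.1 * (galg_fun cs.2 v - s0 v), cs.2) |
  cs <- l1 & galg_fun cs.2 v != s0 v].
have [||||x Mx] := IHn l2.
- by rewrite size_map (leq_ltn_trans _ szl) // size_filter count_size.
- apply/allP => _ /mapP[cs + ->]; rewrite mem_filter => /andP[csv csl] /=.
  by rewrite mulf_neq0 ?subr_eq0 //; exact: (allP lc).
- rewrite -map_comp; apply: subseq_uniq lu; apply: map_subseq.
  exact: filter_subseq.
- by rewrite size_map size_filter /= vs.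
rewrite big_map big_filter /=.
have -> : \sum_(cs <- l1 | galg_fun cs.2 v != s0 v)
      cs.1 * (galg_fun cs.2 v - s0 v) * galg_fun cs.2 x =
    \sum_(cs <- (c0, s0) :: l1) cs.1 * galg_fun cs.2 (v * x)
    - s0 v * \sum_(cs <- (c0, s0) :: l1) cs.1 * galg_fun cs.2 x.
  rewrite mulr_sumr -sumrB [RHS]big_cons /= galg_mul mulrCA subrr add0r.
  rewrite big_mkcond /=; apply: eq_bigr => cs _; rewrite galg_mul.
  by case: eqP => [->|_] /=; [rewrite mulrCA subrr | ring].
have [->|x0 _] := eqVneq (\sum_(cs <- (c0, s0) :: l1) cs.1 * galg_fun cs.2 x) 0.
  by rewrite mulr0 subr0; exists (v * x); [apply: MM => //; exact: Mu|].
by exists x.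
Qed.

Section QuadraticCharacter.
Local Notation C1 := (cochain (trivialModule G 'F_2) 1).
Variable x : C1.
Hypothesis dx : differential x = 0.

Let xM g h : ev1 x (g * h)%g = ev1 x g + ev1 x h.
Proof. exact: (cocycle1P x).2. Qed.

Let sgn (b : bool) : L := (-1) ^+ b.
Let X g := ev1 x g != 0.

Lemma odd_char_mul g h : X (g * h)%g = X g (+) X h.
Proof.
by rewrite /X xM; case: (ev1 x g) (ev1 x h) => [[|[|]] //=] ? [[|[|]] //=] ?.
Qed.

(** Hilbert 90 by a Lagrange resolvent: sum (-1)^x(s) s(t) over the images of [u] under G, with one
    [s] per image and [t] chosen by independence to make the sum nonzero. *)
Lemma quadratic_kummer : exists2 a : L, a != 0 &
  forall g : G, g a = sgn (X g) * a.
Proof.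
have x1 : ev1 x 1%g = 0.
  have /eqP := xM 1%g 1%g.
  by rewrite mul1g -[X in X == _]addr0 (inj_eq (addrI _)) => /eqP.
have [u uP] : exists u : seq L, forall g : G, {in u, g =1 id} -> ev1 x g = 0.
  by have [u uP] := ev1_near x 1%g; exists u => g gu; rewrite -x1; apply: uP.
have onseqX (g h : G) : onseq u g = onseq u h -> ev1 x g = ev1 x h.
  move=> /onseqP gh; have : ev1 x (h^-1 * g)%g = 0.
    by apply: uP => y yu; rewrite -[LHS]/((h^-1)%g (g y)) gh // (galgVK h).1.
  by rewrite xM => h1; rewrite -[RHS]add0r -h1 addrAC -xM mulVg x1 add0r.
(* The field fixed by the pointwise stabilizer of [u]; on it, as in [x], an automorphism matters
   only through its effect on [u]. *)
pose M (t : L) := forall n : G, {in u, n =1 id} -> n t = t.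
have Meq t (g h : G) : M t -> onseq u g = onseq u h -> g t = h t.
  move=> Mt /onseqP gh; have : (h^-1 * g)%g t = t.
    by apply: Mt => y yu; rewrite -[LHS]/((h^-1)%g (g y)) gh // (galgVK h).1.
  by rewrite -[LHS]/((h^-1)%g (g t)) => {2}<-; rewrite (galgVK h).2.
have [V VP] := galg_finite u.
pose isval v := `[< exists g : G, onseq u g = v >].
pose rep v : G := if pselect (exists g : G, onseq u g = v) is left e
  then projT1 (cid e) else 1%g.
have repK v : isval v -> onseq u (rep v) = v.
  by move=> /asboolP ev; rewrite /rep; case: pselect => // e; case: cid.
pose Vals := [seq v <- undup V | isval v].
have ValsP v : (v \in Vals) = isval v.
  rewrite mem_filter mem_undup andb_idr // => /asboolP[g <-]; exact: VP.
have uVals : uniq Vals by rewrite filter_uniq // undup_uniq.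
pose l := [seq (sgn (X (rep v)), rep v) | v <- Vals].
have lV : [seq onseq u cs.2 | cs <- l] = Vals.
  rewrite -map_comp -[RHS]map_id; apply/eq_in_map => v.
  by rewrite ValsP => /repK.
have [||||||t Mt t0] := @galg_independent M u l.
- by move=> n _; exact: galg_one.
- by move=> y z My Mz n nu; rewrite galg_mul My ?Mz.
- by move=> y yu n nu; exact: nu.
- by apply/allP => _ /mapP[v _ ->] /=; rewrite /sgn signr_eq0.
- by rewrite lV.
- rewrite size_map; suff : onseq u 1%g \in Vals by case: (Vals).
  by rewrite ValsP; apply/asboolP; exists 1%g.
rewrite big_map /= in t0.
exists (\sum_(v <- Vals) sgn (X (rep v)) * rep v t) => // g.
have gV v : isval v -> isval (map g v).
  by move=> /asboolP[h <-]; apply/asboolP; exists (g * h)%g; rewrite /onseq -map_comp.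
(* [g] permutes the images of [u], which reindexes the resolvent. *)
have pV : perm_eq [seq map g v | v <- Vals] Vals.
  have gu : uniq [seq map g v | v <- Vals].
    by rewrite map_inj_uniq //; apply: inj_map; exact: galg_inj.
  have [|||_ eqV] := @uniq_min_size _ [seq map g v | v <- Vals] Vals => //.
  - by move=> _ /mapP[v + ->]; rewrite !ValsP; exact: gV.
  - by rewrite size_map.
  - exact: uniq_perm.
rewrite -[in RHS](perm_big _ pV) big_map mulr_sumr /=.
rewrite (big_morph g (galgD g) (galg0 g)) !big_seq.
apply: eq_bigr => v; rewrite ValsP => vV.
have rE : onseq u (rep (map g v)) = onseq u (g * rep v)%g.
  by rewrite repK; [rewrite -{1}(repK v vV) /onseq -map_comp | exact: gV].
rewrite (Meq t _ _ Mt rE) galg_mul.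
have -> : X (rep (map g v)) = X g (+) X (rep v).
  by rewrite -odd_char_mul /X (onseqX _ _ rE).
have sgnK b : g (sgn b) = sgn b by rewrite /sgn galgX galgN galg_one.
by rewrite sgnK mulrA -signr_addb addbA addbb.
Qed.

Variable j : L.
Hypotheses (jE : j ^+ 2 = -1) (L2 : (2%:R : L) != 0).
Variable c : C1.
Hypothesis cE : forall g, ev1 c g = if fixes_i j g then 0 else 1.

(* With [b ^+ 4 = a ^+ 2] for a Kummer generator [a] of [x], every [g] maps [b]
   to [(-1) ^+ y g * j ^+ x g * b], and [y] bounds [x x + c x]. *)
Lemma cup_square : exists y : C1, cup11 x x + cup11 c x = differential y.
Proof.
have [a a0 aE] := quadratic_kummer.
have [b bE] := sqrt_exists sepL a L2.
have b0 : b != 0 by apply: contraNneq a0 => b0; rewrite -bE b0 expr0n.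
pose J (e : bool) : L := if e then j else 1.
have j0 : j != 0.
  by apply/eqP => j0; move/eqP: jE; rewrite j0 expr0n /= eq_sym oppr_eq0 oner_eq0.
have JM e e' : J e * J e' = sgn (e && e') * J (e (+) e').
  by case: e e' => [] []; rewrite /J /sgn /= ?mulr1 ?mul1r // mulN1r -expr2 jE.
pose C (g : G) := ~~ fixes_i j g.
have gJ (g : G) e : g (J e) = sgn (C g && e) * J e.
  case: e; rewrite /J /C /sgn ?andbT ?andbF ?mul1r ?galg_one // (galg_i jE).
  by case: fixes_i; rewrite /= ?mul1r ?mulN1r.
have sgnM e e' : sgn e * sgn e' = sgn (e (+) e') by rewrite /sgn signr_addb.
have gsgn (g : G) e : g (sgn e) = sgn e by rewrite /sgn galgX galgN galg_one.
pose Y (g : G) := g b != J (X g) * b.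
have Jb0 e : J e * b != 0 by rewrite mulf_neq0 //; case: e; rewrite /J ?oner_eq0.
have YE (g : G) : g b = sgn (Y g) * (J (X g) * b).
  rewrite /Y; case: eqP => [//|] /=; first by rewrite mul1r.
  move=> /eqP gb; rewrite mulN1r; apply/eqP.
  have : g b ^+ 2 == (J (X g) * b) ^+ 2.
    rewrite -galgX bE aE exprMn bE /J; case: (X g); rewrite ?jE ?expr1n /sgn //=.
  by rewrite eqf_sqr (negPf gb).
have YP (g : G) e : g b = sgn e * (J (X g) * b) -> Y g = e.
  move=> gb; rewrite /Y gb -subr_eq0 -{2}[_ * b]mul1r -mulrBl mulf_eq0 negb_or.
  rewrite Jb0 andbT; case: e {gb}; rewrite /sgn /= ?subrr ?eqxx //.
  by rewrite -opprD oppr_eq0.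
(* Apply [g] to h b = (-1)^(Y h) j^(X h) b: the term [C g && X h] is the sign of [g] on j^(X h), and
   [X g && X h] comes from j^2 = -1. *)
have YM g h : Y (g * h)%g = Y g (+) Y h (+) (X g && X h) (+) (C g && X h).
  apply: YP; rewrite -[LHS]/(g (h b)) (YE h) !galg_mul gsgn gJ (YE g).
  rewrite odd_char_mul -!sgnM addbC.
  rewrite [X h (+) X g]addbC; have := JM (X g) (X h).
  set A := J _; set B := J _; set D := J _ => AB.
  transitivity (sgn (Y h) * sgn (C g && X h) * sgn (Y g) * (A * B) * b).
    by ring.
  by rewrite AB; ring.
have YC g : \forall h \near g,
    (if Y h then 1 else 0 : FpField 2) = if Y g then 1 else 0.
  near=> h; rewrite /Y /X.
  have -> : ev1 x h = ev1 x g by near: h; exact: ev1_near.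
  have -> // : h b = g b.
  by near: h; exists [:: b] => h; apply; rewrite inE.
have F2 (e e' : bool) : (if e (+) e' then 1 else 0 : FpField 2) =
    (if e then 1 else 0) + if e' then 1 else 0.
  by case: e e' => [] [] //=; apply/val_inj.
have xE g : ev1 x g = if X g then 1 else 0.
  by rewrite /X; case: (ev1 x g) => [[|[|]] //=] ?; apply/val_inj.
exists (mk1 YC); apply: ev2_inj => g h; rewrite !evE !ev_mk1 YM !F2 cE !xE /C.
by case: (Y g) (Y h) (X g) (X h) (fixes_i j g) => [] [] [] [] []; apply/val_inj.
Unshelve. all: by end_near. Qed.
End QuadraticCharacter.
End Kummer.

(** * The Boolean ring of cup products *)

Section BooleanPairing.
Variables (V H : zmodType) (q : V -> V -> H) (chi : V).
Hypothesis qBl : forall z, zmod_morphism (q^~ z).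
Hypothesis qC : forall x y, q x y = q y x.
Hypothesis q_surj : forall h, exists u, h = q chi u.
(** Associativity (x y) z = x (y z) for the product on [H], with [u] and [v] representing x y and y
    z. *)
Hypothesis qA : forall x y z u v,
  q x y = q chi u -> q y z = q chi v -> q u z = q x v.
Hypothesis q_idem : forall x, q x x = q chi x.

Let q0l z : q 0 z = 0.
Proof. by rewrite -[X in q X _](subrr 0) qBl subrr. Qed.
Let qDl z : {morph q^~ z : x y / x + y}.
Proof. by move=> x y /=; rewrite -[y in LHS]opprK -[- y]sub0r !qBl q0l sub0r opprK. Qed.
Lemma pairing_suml I (r : seq I) (P : pred I) (F : I -> V) z :
  q (\sum_(i <- r | P i) F i) z = \sum_(i <- r | P i) q (F i) z.
Proof. exact: (big_morph (q^~ z) (qDl z) (q0l z)). Qed.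
Let q0r z : q z 0 = 0. Proof. by rewrite qC q0l. Qed.
Let qBr z x y : q z (x - y) = q z x - q z y.
Proof. by rewrite qC qBl !(qC _ z). Qed.
Let qDr z x y : q z (x + y) = q z x + q z y.
Proof. by rewrite qC qDl !(qC _ z). Qed.
Let q_sumr I (r : seq I) (P : pred I) (F : I -> V) z :
  q z (\sum_(i <- r | P i) F i) = \sum_(i <- r | P i) q z (F i).
Proof. by rewrite qC pairing_suml; apply: eq_bigr => i _; rewrite qC. Qed.

(** If t y = chi w, associativity applied to [chi], [t], [y] gives chi w = 0 y, because [chi t] is
    represented by 0. *)
Lemma pairing_absorb t y : q chi t = 0 -> q t y = 0.
Proof.
move=> t0; have [w qw] := q_surj (q t y).
by rewrite qw -(@qA chi t y 0 w) ?q0l // q0r.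
Qed.

Lemma pairing_eql x x' y : q chi x = q chi x' -> q x y = q x' y.
Proof.
move=> xx; apply/eqP; rewrite -subr_eq0 -qBl; apply/eqP/pairing_absorb.
by rewrite qBr xx subrr.
Qed.

Lemma pairing_orth u x e z : q chi u = q x e -> q e z = 0 -> q u z = 0.
Proof. by move=> ue ez; rewrite (@qA x e z u 0) ?q0r. Qed.

(** Here (x e) e = x (e e) = x e. *)
Lemma pairing_proj u x e : q chi u = q x e -> q u e = q x e.
Proof. by move=> ue; rewrite (@qA x e e u e). Qed.

(** The elements [q chi (e j)] are orthogonal idempotents; the second clause says that they add up
    to the unit. *)
Definition orthogonal_system (J : finType) (e : J -> V) : Prop :=
  (forall j k, j != k -> q (e j) (e k) = 0) /\
  (forall y, q chi y = \sum_j q (e j) y).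

(** Each new [a N] splits every idempotent [e j] into [e j * a N], represented by [u j], and its
    complement in [e j]. *)
Lemma orthogonal_refinement (a : nat -> V) N :
  exists (J : finType) (e : J -> V) (c : nat -> J -> bool),
    orthogonal_system e /\
    forall i, (i < N)%N -> q chi (a i) = q chi (\sum_(j | c i j) e j).
Proof.
elim: N => [|N [J [e [c [[eO e1] ac]]]]].
  exists unit, (fun=> chi), (fun _ _ => true); split=> //; split=> [[] []|y] //.
  by rewrite (big_pred1 tt) // => -[].
have [u uE] := choice (fun j => q_surj (q (e j) (a N))).
exists (J * bool)%type, (fun jb => if jb.2 then u jb.1 else e jb.1 - u jb.1).
exists (fun i jb => if i == N then jb.2 else c i jb.1).
have eu j k : j != k -> q (u j) (e k) = 0.
  by move=> jk; apply: (@pairing_orth _ (a N) (e j)); [rewrite -uE qC | exact: eO].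
have uu j k : j != k -> q (u j) (u k) = 0.
  move=> jk; apply: (@pairing_orth _ (a N) (e j)); first by rewrite -uE qC.
  by rewrite qC eu // eq_sym.
have ue j : q (u j) (e j) = q (u j) (u j).
  by rewrite (@pairing_proj _ (a N)) ?q_idem -?uE // qC.
split; first split.
- move=> [j b] [k b'] /=; have [<-{k}|jk _] := eqVneq j k.
    rewrite xpair_eqE eqxx /=.
    case: b b' => [] [] //= _; rewrite ?qBr ?qBl ?(qC (e j) (u j)) ?ue ?subrr //.
  have kj : k != j by rewrite eq_sym.
  by case: b b' => [] []; rewrite ?qBr ?qBl ?(qC (e j) (u k)) ?eO ?eu ?uu ?subrr.
- move=> y; rewrite e1 -(pair_bigA _ (fun j b => q (if b then u j else e j - u j) y)).
  by apply: eq_bigr => j _; rewrite big_bool /= -qDl addrC subrK.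
- move=> i; rewrite ltnS leq_eqVlt; case: eqP => [-> _ | _ /= iN].
    rewrite q_sumr -(pair_big_dep xpredT (fun j b => b)
      (fun j b => q chi (if b then u j else e j - u j))) /=.
    rewrite e1; apply: eq_bigr => j _; rewrite big_mkcond big_bool /= addr0 -uE //.
  rewrite ac // !q_sumr [RHS](eq_bigl (fun jb => c i jb.1 && true)); last first.
    by move=> jb; rewrite andbT.
  rewrite -(pair_big_dep (c i) (fun j b => true)
    (fun j b => q chi (if b then u j else e j - u j))) /=.
  by apply: eq_bigr => j _; rewrite big_bool /= -qDr addrC subrK.
Qed.

Lemma orthogonal_decomposition (a : nat -> V) N :
  (forall i, (i.+1 < N)%N -> q (a i) (a i.+1) = 0) ->
  exists (J : finType) (e : J -> V) (t : nat -> V) (c : nat -> J -> bool),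
  [/\ orthogonal_system e, forall i, (i < N)%N -> q chi (t i) = 0,
      forall i, a i = \sum_(j | c i j) e j + t i &
      forall i j, ~~ (c i j && c i.+1 j)].
Proof.
move=> aa; have [J [e [c [eOS ac]]]] := orthogonal_refinement a N.
have [eO e1] := eOS.
(* Zero idempotents are left out of the supports and end up in the remainder. *)
pose c' i j := [&& (i < N)%N, c i j & q chi (e j) != 0].
exists J, e, (fun i => a i - \sum_(j | c' i j) e j), c'; split=> //.
- move=> i iN; rewrite qBr ac // !q_sumr; apply/eqP; rewrite subr_eq0; apply/eqP.
  rewrite big_mkcond [RHS]big_mkcond; apply: eq_bigr => j _; rewrite /c' iN /=.
  by case: (c i j) => //=; case: eqP.
- by move=> i; rewrite addrC subrK.
move=> i k; apply/negP => /andP[/and3P[iN ck ek] /and3P[iN' ck' _]].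
(* By orthogonality [w] represents the product of [a i] and its successor, so it is zero; but its
   [e k] component is the nonzero [e k]. *)
pose w := \sum_(j | c i j && c i.+1 j) e j.
have : q chi w = 0.
  rewrite -(aa i iN') (pairing_eql _ (ac i iN)) [RHS]qC (pairing_eql _ (ac i.+1 iN')).
  rewrite [RHS]qC pairing_suml q_sumr big_mkcondr; apply: eq_bigr => j cj.
  rewrite q_sumr; case: ifP => c'j.
    rewrite (bigD1 j) //= big1 ?addr0 ?q_idem // => l /andP[_ lj].
    by rewrite eO // eq_sym.
  rewrite big1 // => l c'l; rewrite eO //; apply: contraTneq c'l => <-.
  by rewrite c'j.
move=> /(pairing_absorb (e k)); rewrite pairing_suml (bigD1 k) ?ck //= big1.
  by rewrite addr0 q_idem => /eqP; rewrite (negPf ek).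
by move=> j /andP[_ jk]; exact: eO.
Qed.

End BooleanPairing.

Section Letters.
Variables (J T : finType).
Implicit Types (l : J + T) (w z : seq (J + T)).

(** [inl] letters stand for the idempotents and [inr] letters for annihilated classes; compatible
    letters have zero product. *)
Definition compatible : rel (J + T) := fun l l' =>
  match l, l' with inl j, inl k => j != k | _, _ => true end.

End Letters.

(** * Removing obstructions by changing the longest words *)

Section Correction.
Variables (V H : zmodType) (q : V -> V -> H) (chi : V).
Hypothesis qBl : forall z, zmod_morphism (q^~ z).
Hypothesis qC : forall x y, q x y = q y x.
Hypothesis q_surj : forall h, exists u, h = q chi u.
Hypothesis qA : forall x y z u v,
  q x y = q chi u -> q y z = q chi v -> q u z = q x v.
Hypothesis q_idem : forall x, q x x = q chi x.
Variables (J T : finType) (x : J + T -> V).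
Let q_sumr I (r : seq I) (P : pred I) (F : I -> V) z :
  q z (\sum_(i <- r | P i) F i) = \sum_(i <- r | P i) q z (F i).
Proof.
by rewrite qC (pairing_suml qBl); apply: eq_bigr => i _; rewrite qC.
Qed.
Hypothesis eOS : orthogonal_system q chi (fun j => x (inl j)).
Hypothesis xT : forall t, q chi (x (inr t)) = 0.
Local Notation e := (fun j => x (inl j)).
Local Notation adm := (sorted (@compatible J T)).

Lemma compatible_orth l l' : compatible l l' -> q (x l) (x l') = 0.
Proof.
have absorb := pairing_absorb qBl qC q_surj qA.
case: l l' => [j|t] [k|t'] /=; try by rewrite absorb.
  by move=> jk; exact: eOS.1.
by rewrite qC absorb.
Qed.

Lemma letter_pairing l y :
  q (x l) y = \sum_j if l == inl j then q (x (inl j)) y else 0.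
Proof.
rewrite -big_mkcond; case: l => [k|t].
  by rewrite (big_pred1 k) // => j; rewrite /= eq_sym.
by rewrite big_pred0 // (pairing_absorb qBl qC q_surj qA).
Qed.

Variables (m : nat) (v : seq (J + T) -> V).
(** [chi * v w] is to be the obstruction at the word [w]; this is the relation between obstructions
    in H^3 after [chi] is cancelled. *)
Hypothesis juggle : forall l z l', size z = m.+1 -> adm (l :: rcons z l') ->
  q (x l) (v (rcons z l')) = q (v (l :: z)) (x l').

(** Since [j] may be put in front of the word, juggling makes the [j] component a multiple of
    [x l'], which is orthogonal to [e j]. *)
Lemma component_eq0 j l z l' : size z = m -> adm (l :: rcons z l') ->
  inl j != l -> inl j != l' -> q (x (inl j)) (v (l :: rcons z l')) = 0.
Proof.
move=> zm wA jl jl'.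
have jw : adm (inl j :: rcons (l :: z) l').
  by case: l jl wA => //= k jk ->; rewrite andbT.
have := juggle (z := l :: z) _ jw; rewrite /= zm => /(_ erefl) eQ.
have [u uE] := q_surj (q (x (inl j)) (v (l :: rcons z l'))).
have : q u (x (inl j)) = 0.
  apply: (pairing_orth qBl qC qA (x := v [:: inl j, l & z]) (e := x l')).
    by rewrite -uE.
  by apply: compatible_orth; case: l' jl' {jw wA eQ uE} => //= k; rewrite eq_sym.
rewrite (pairing_proj qA q_idem (x := v (l :: rcons z l'))); first by rewrite qC.
by rewrite -uE qC.
Qed.

Lemma correction : exists g : seq (J + T) -> V,
  forall l z l', size z = m -> adm (l :: rcons z l') ->
  q chi (v (l :: rcons z l')) =
  q (x l) (g (rcons z l')) + q (g (l :: z)) (x l').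
Proof.
have [u uE] := choice (fun jw : J * seq (J + T) =>
  q_surj (q (x (inl jw.1)) (v jw.2))).
(* The test whether [j] may precede the word; it keeps a word with [j] at both ends from being
   counted twice. *)
pose hd (j : J) (y : seq (J + T)) :=
  if y is l :: _ then compatible (inl j) l else true.
(* The [j] component of [g y] is that of [v] at [y] preceded by [j]. For l = j the first term then
   gives the required component; for l' = j and l different from j, juggling identifies it with the
   second. *)
pose g y := \sum_(j | hd j y) u (j, inl j :: y).
have gE j y : q (x (inl j)) (g y) =
    if hd j y then q (x (inl j)) (v (inl j :: y)) else 0.
  have uO k : k != j -> q (x (inl j)) (u (k, inl k :: y)) = 0.
    move=> kj; rewrite qC.
    apply: (pairing_orth qBl qC qA (x := v (inl k :: y)) (e := x (inl k))).
      by rewrite -uE qC.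
    exact: eOS.1.
  rewrite q_sumr; case: ifP => jy; last first.
    by rewrite big1 // => k ky; apply: uO; apply: contraTneq ky => ->; rewrite jy.
  rewrite (bigD1 j) //= big1 ?addr0; last by move=> k /andP[_ /uO].
  rewrite qC (pairing_proj qA q_idem (x := v (inl j :: y))); first by rewrite qC.
  by rewrite -uE qC.
exists g => l z l' zm wA.
rewrite eOS.2 letter_pairing [q (g _) _]qC letter_pairing -big_split /=.
apply: eq_bigr => j _; rewrite !gE.
have [lj|lj] := eqVneq l (inl j).
  have -> : hd j (rcons z l').
    by case: z wA {zm} => [|k z]; rewrite lj /= => /andP[].
  by rewrite lj /= eqxx if_same addr0.
have jl : compatible (inl j) l by case: l lj {wA} => //= k; rewrite eq_sym.
rewrite add0r; have [l'j|l'j] := eqVneq l' (inl j); last first.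
  by apply: component_eq0; rewrite // eq_sym.
have jw : adm (inl j :: rcons (l :: z) l').
  by move: wA => /= ->; move: jl => /= ->.
have -> : hd j (l :: z) = true by exact: jl.
have /= -> := juggle (congr1 S zm : size (l :: z) = m.+1) jw.
by rewrite qC l'j.
Qed.

End Correction.

(** * Defining systems indexed by words *)

Section SumOverWords.
Variables (I : finType) (c : nat -> I -> bool).

(** The multilinear expansion of a product of consecutive factors, the factor at position [i] being
    the sum of the letters in [c i]. *)
Fixpoint word_sum (V : nmodType) i n (phi : seq I -> V) : V :=
  if n is n'.+1
  then \sum_(l | c i l) word_sum i.+1 n' (fun w => phi (l :: w))
  else phi [::].

Lemma word_sum_cat (V : nmodType) i m n (phi : seq I -> V) :
  word_sum i (m + n) phi =
  word_sum i m (fun u => word_sum (i + m) n (fun v => phi (u ++ v))).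
Proof.
elim: m i phi => [|m IHm] i phi; first by rewrite addn0.
by rewrite addSn /=; apply: eq_bigr => l _; rewrite IHm addSnnS.
Qed.

Lemma word_sum_morph (V W : nmodType) (f : V -> W) i n (phi : seq I -> V) :
  f 0 = 0 -> {morph f : x y / x + y} ->
  f (word_sum i n phi) = word_sum i n (f \o phi).
Proof.
move=> f0 fD; elim: n i phi => [|n IHn] i phi //=.
by rewrite (big_morph f fD f0); apply: eq_bigr => l _; rewrite IHn.
Qed.

Lemma word_sum_sum (V : nmodType) i n K (r : seq K) (F : K -> seq I -> V) :
  word_sum i n (fun w => \sum_(k <- r) F k w) =
  \sum_(k <- r) word_sum i n (F k).
Proof.
elim: n i F => [|n IHn] i F //=.
by rewrite exchange_big; apply: eq_bigr => l _; rewrite IHn.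
Qed.

Lemma eq_word_size (V : nmodType) i n (phi psi : seq I -> V) :
  (forall w, size w = n -> phi w = psi w) ->
  word_sum i n phi = word_sum i n psi.
Proof.
elim: n i phi psi => [|n IHn] i phi psi eqf /=; first exact: eqf.
by apply: eq_bigr => l _; apply: IHn => w wn; apply: eqf; rewrite /= wn.
Qed.

Variable r : rel I.
Hypothesis c_r : forall i l l', c i l -> c i.+1 l' -> r l l'.

(** Letters chosen at consecutive positions are related by [r], so only sorted words contribute. *)
Lemma eq_word_sorted (V : nmodType) i n (phi psi : seq I -> V) :
  (forall w, size w = n -> sorted r w -> phi w = psi w) ->
  word_sum i n phi = word_sum i n psi.
Proof.
have eq_path m k l (f g : seq I -> V) : c k l ->
    (forall w, size w = m -> path r l w -> f w = g w) ->
    word_sum k.+1 m f = word_sum k.+1 m g.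
  elim: m k l f g => [|m IHm] k l f g ckl fg /=; first exact: fg.
  apply: eq_bigr => l' cl'; apply: (IHm _ l') => // w wm wl'.
  by apply: fg; rewrite /= ?wm // wl' (c_r ckl cl').
case: n => [|n] fg /=; first exact: fg.
apply: eq_bigr => l cl; apply: (eq_path _ _ l) => // w wn wl.
by apply: fg => //=; rewrite wn.
Qed.

End SumOverWords.

Section WordSystems.
Variables (G : topologicalGroupType) (p : nat).
Local Notation Fp := (trivialModule G 'F_p).
Local Notation "'C^ n" := (cochain Fp n) (at level 8, n at level 2).
Local Notation "'Z^ n" := (cocycle Fp n) (at level 8, n at level 2).
Local Notation "'H^ n" := (cohomology Fp n) (at level 8, n at level 2).

Section Curvature.
Variables (I : eqType) (A : seq I -> 'C^1).

(** The right-hand side of the defining equation at [w], and the obstruction to solving it. *)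
Definition curvature (w : seq I) : 'C^2 :=
  \sum_(1 <= k < size w) cup11 (A (take k w)) (A (drop k w)).

(** Both sides run over the factorizations of [w] into three nonempty words. *)
Lemma bianchi (w : seq I) :
  \sum_(1 <= k < size w) cup21 (curvature (take k w)) (A (drop k w)) =
  \sum_(1 <= k < size w) cup12 (A (take k w)) (curvature (drop k w)).
Proof.
pose T l m := cup21 (cup11 (A (take l w)) (A (drop l (take m w)))) (A (drop m w)).
transitivity (\sum_(1 <= m < size w) \sum_(1 <= l < size w)
    if (l < m)%N then T l m else 0).
  apply: eq_big_nat => m /andP[m0 mw]; rewrite cup21_suml size_takel 1?ltnW //.
  rewrite -big_mkcond [LHS](big_nat_widen _ _ (size w)) 1?ltnW //=.
  apply: eq_bigr => l lm; by rewrite /T take_takel // ltnW.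
rewrite exchange_big; apply: eq_big_nat => l /andP[l0 lw].
transitivity (\sum_(l.+1 <= m < size w) T l m).
  by rewrite [RHS](big_nat_widenl _ 1) //= [RHS]big_mkcond.
rewrite -[l.+1]add1n big_addn cup12_sumr size_drop; apply: eq_bigr => k _.
by rewrite /T cup11A drop_drop take_drop.
Qed.

(** The Leibniz rule; [bianchi] allows the curvature terms to be subtracted on both sides. *)
Lemma differential_curvature (w : seq I) :
  differential (curvature w) =
  \sum_(1 <= k < size w)
    cup21 (differential (A (take k w)) - curvature (take k w)) (A (drop k w)) -
  \sum_(1 <= k < size w)
    cup12 (A (take k w)) (differential (A (drop k w)) - curvature (drop k w)).
Proof.
have cupB1 u v f : cup21 (u - v) f = cup21 u f - cup21 v f.
  apply: ev3_inj => x y z; ring_ev.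
have cupB2 u v f : cup12 f (u - v) = cup12 f u - cup12 f v.
  apply: ev3_inj => x y z; ring_ev.
rewrite raddf_sum; under eq_bigr do rewrite /= differential_cup11.
under [X in _ = X - _]eq_bigr do rewrite cupB1.
under [X in _ = _ - X]eq_bigr do rewrite cupB2.
by rewrite !sumrB bianchi opprB addrA subrK.
Qed.

End Curvature.
End WordSystems.

(** * From systems on words to Massey products *)

Section MasseyFromWords.
Variables (G : topologicalGroupType) (p : nat).
Local Notation Fp := (trivialModule G 'F_p).
Local Notation "'C^ n" := (cochain Fp n) (at level 8, n at level 2).
Local Notation "'Z^ n" := (cocycle Fp n) (at level 8, n at level 2).
Local Notation "'H^ n" := (cohomology Fp n) (at level 8, n at level 2).

Lemma eq_curvature (I : eqType) (A A' : seq I -> 'C^1) (w : seq I) :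
  (forall u, (0 < size u < size w)%N -> A u = A' u) ->
  curvature A w = curvature A' w.
Proof.
move=> AA; apply: eq_big_nat => k /andP[k0 kw]; rewrite !AA //.
  by rewrite size_drop subn_gt0 kw /= -subn_gt0 subKn // ltnW.
by rewrite size_takel ?k0 // ltnW.
Qed.

Variables (I : finType) (x : I -> 'C^1) (r : rel I).

Definition word_system n (A : seq I -> 'C^1) : Prop :=
  (forall l, A [:: l] = x l) /\
  (forall w, (0 < size w <= n)%N -> sorted r w ->
     differential (A w) = curvature A w).

Lemma curvature_cocycle n A w : word_system n A -> (size w <= n.+1)%N ->
  sorted r w -> differential (curvature A w) = 0.
Proof.
move=> [_ dA] wn wr; rewrite differential_curvature.
have dA0 k : (1 <= k < size w)%N ->
    differential (A (take k w)) - curvature A (take k w) = 0 /\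
    differential (A (drop k w)) - curvature A (drop k w) = 0.
  move=> /andP[k0 kw]; rewrite !dA ?subrr ?take_sorted ?drop_sorted //;
    rewrite ?size_drop ?size_take_min; move: k0 kw wn; clear; lia.
rewrite !big_nat !big1 ?subrr // => k /dA0[d1 d2].
  by rewrite d2; apply: ev3_inj => g h t; rewrite !evE mulr0.
by rewrite d1; apply: ev3_inj => g h t; rewrite !evE mul0r.
Qed.

Hypothesis dx : forall l, differential (x l) = 0.

(** The two outer terms are the ones in which words only one letter shorter occur, hence those
    affected by a correction there. *)
Lemma curvature_ends (A : seq I -> 'C^1) n l z l' : size z = n.+1 ->
  curvature A (l :: rcons z l') =
  cup11 (A [:: l]) (A (rcons z l')) +
  \sum_(2 <= k < n.+2) cup11 (A (take k (l :: rcons z l')))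
    (A (drop k (l :: rcons z l'))) +
  cup11 (A (l :: z)) (A [:: l']).
Proof.
move=> zn; rewrite /curvature /= size_rcons zn big_nat_recr //= big_ltn //=.
by rewrite take0 drop0 -zn -cats1 take_size_cat // drop_size_cat.
Qed.

(* The cochain analogue of [x <y, .., z> = <x, .., y> z] for Massey products. *)
Lemma juggling n A l z l' : word_system n.+1 A -> size z = n.+1 ->
  sorted r (l :: rcons z l') ->
  exists W : 'C^2, differential W =
    cup12 (x l) (curvature A (rcons z l')) -
    cup21 (curvature A (l :: z)) (x l').
Proof.
move=> [Ax dA] zn wr; set w := l :: rcons z l' in wr *.
have wn : size w = n.+3 by rewrite /= size_rcons zn.
(* Without its two end terms, the curvature has only factors short enough for the equations to
   hold. *)
exists (curvature A w - cup11 (A (l :: z)) (x l') - cup11 (x l) (A (rcons z l'))).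
have := differential_curvature A w; rewrite wn big_nat_recr //= big1_seq; last first.
  move=> k /andP[_]; rewrite mem_index_iota => /andP[k0 kn].
  rewrite dA ?take_sorted ?subrr // ?size_take_min ?wn.
    by apply: ev3_inj => g h t; rewrite !evE mul0r.
  by move: k0 kn; clear; lia.
rewrite add0r big_ltn // [X in _ = _ - (_ + X)]big1_seq; last first.
  move=> k /andP[_]; rewrite mem_index_iota => /andP[k0 kn].
  rewrite dA ?drop_sorted ?subrr // ?size_drop ?wn.
    by apply: ev3_inj => g h t; rewrite !evE mulr0.
  by move: k0 kn; clear; lia.
rewrite /= take0 drop0 addr0 -zn -cats1 take_size_cat // drop_size_cat // !Ax => dW.
rewrite !raddfB /= dW !differential_cup11 !dx; apply: ev3_inj => g h t; ring_ev.
Qed.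

Hypothesis r_cup : forall l l', r l l' ->
  exists y : 'C^1, cup11 (x l) (x l') = differential y.

Lemma extend_word_system n A : word_system n.+1 A ->
  (forall w, size w = n.+2 -> sorted r w ->
     exists y : 'C^1, curvature A w = differential y) ->
  exists A', word_system n.+2 A'.
Proof.
move=> [Ax dA] cA.
have [w|Y YP] := @choice _ _ (fun w (y : 'C^1) => size w = n.+2 ->
    sorted r w -> curvature A w = differential y).
  have [/andP[/eqP wn wr]|wnr] := boolP ((size w == n.+2) && sorted r w).
    by have [y yP] := cA w wn wr; exists y.
  by exists 0 => wn wr; move: wnr; rewrite wn wr eqxx.
pose A' w := if size w == n.+2 then Y w else A w.
have cE w : (size w <= n.+2)%N -> curvature A' w = curvature A w.
  move=> wn; apply: eq_curvature => u /andP[_ uw].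
  by rewrite /A' ltn_eqF // (leq_trans uw).
exists A'; split=> [l|w /andP[w0 wn] wr]; first by rewrite /A' /=.
rewrite cE // /A'; case: eqP => [wE|/eqP wE]; first by rewrite YP.
by rewrite dA // w0 -ltnS ltn_neqAle wE.
Qed.

(** The step may alter the system before extending it. It starts with systems on words of length
    two, so that the letters stay fixed; obstructions at length two are handled by [r_cup]. *)
Lemma word_system_exists :
  (forall n A, word_system n.+2 A -> exists2 A', word_system n.+2 A' &
     forall w, size w = n.+3 -> sorted r w ->
       exists y : 'C^1, curvature A' w = differential y) ->
  forall n, exists A, word_system n.+1 A.
Proof.
move=> step; elim=> [|n [A sA]].
  exists (fun w => if w is [:: l] then x l else 0); split=> // -[|l [|l' w]] //= _ _.
  by rewrite dx /curvature big_geq.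
case: n sA => [|n] sA; last first.
  by have [A' sA' cA'] := step n A sA; exact: extend_word_system sA' cA'.
apply: (extend_word_system sA) => -[|l [|l' [|//]]] //= _ /andP[ll' _].
by rewrite /curvature big_nat1 /= !sA.1; exact: r_cup.
Qed.

Variable c : nat -> I -> bool.
Hypothesis c_r : forall i l l', c i l -> c i.+1 l' -> r l l'.

(** Summing [A] over the words that can occupy an interval of positions gives a defining system,
    because cup products are bilinear. *)
Lemma massey_of_word_system n (a : nat -> 'Z^1) A :
  word_system n A ->
  (forall i, (1 <= i <= n)%N -> a i = \sum_(l | c i l) x l :> 'C^1) ->
  massey_vanishes n (fun i => cohomology_class (a i)).
Proof.
move=> [Ax dA] aE.
pose M i j : 'C^1 := word_sum c i (j - i) A.
have dM i j : (1 <= i)%N -> (i < j)%N -> (j <= n.+1)%N ->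
    differential (M i j) = \sum_(i.+1 <= k < j) cup11 (M i k) (M k j).
  move=> i0 ij jn.
  rewrite /M (word_sum_morph _ _ _ (f := @differential G Fp 1)); last 2 first.
  - exact: raddf0.
  - exact: raddfD.
  transitivity (word_sum c i (j - i) (curvature A)).
    apply: (eq_word_sorted c_r) => w wE wr /=; rewrite dA //.
    by move: wE i0 ij jn; clear; lia.
  transitivity (word_sum c i (j - i) (fun w => \sum_(1 <= k < j - i)
      cup11 (A (take k w)) (A (drop k w)))).
    by apply: eq_word_size => w <-.
  rewrite word_sum_sum -[i.+1]add1n big_addn; apply: eq_big_nat => k /andP[k0 kij].
  rewrite addnK; have jE : (j - i = k + (j - (k + i)))%N.
    by rewrite subnDA subnAC subnKC // ltnW.
  rewrite [in LHS]jE word_sum_cat addnC.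
  rewrite (word_sum_morph _ _ _
    (f := fun f => cup11 f (word_sum c (k + i) (j - (k + i)) A))); last 2 first.
  - by apply: ev2_inj => g h; rewrite !evE mul0r.
  - by move=> f f'; rewrite cup11Dl.
  apply: eq_word_size => u uk /=.
  rewrite (word_sum_morph _ _ _ (f := cup11 (A u))); last 2 first.
  - exact: raddf0.
  - exact: raddfD.
  apply: eq_word_size => v vk /=.
  by rewrite take_size_cat // drop_size_cat.
exists M.
  split=> [i j i0 ij jn _|i iP]; first exact: dM.
  exists (a i) => //; rewrite /M subSnn /= (aE i iP).
  by apply: eq_bigr => l _.
(* For positive [n] the entry [M 1 n.+1] bounds the Massey product; for n = 0 the sum is empty. *)
have [n1|n1] := ltnP 1 n.+1.
  have dM1 : differential (M 1%N n.+1) \in @cocycle_pred G Fp 2.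
    by apply/eqP; exact: differentialK.
  exists (Cocycle dM1); first by rewrite -dM.
  by apply/cohomology_class_eq0; exists (M 1%N n.+1).
exists 0; first by rewrite big_geq // (leq_trans n1).
exact: raddf0.
Qed.

End MasseyFromWords.

(** * Vanishing second cohomology *)

Section Acyclic.
Variables (G : topologicalGroupType) (p : nat).
Local Notation Fp := (trivialModule G 'F_p).

Lemma strong_massey_of_H2_eq0 :
  (forall z : cochain Fp 2, differential z = 0 ->
     exists y : cochain Fp 1, z = differential y) ->
  strong_massey_vanishing G p.
Proof.
move=> H2 n a n3 _.
have [f fE] := choice (fun i => cohomology_class_surj (a i)).
have -> : a = (fun i => cohomology_class (f i)) by apply/funext.
(* The letters are the positions themselves, all words are allowed, and position [i] carries only
   the letter [i]. *)
pose x (l : 'I_n.+1) : cochain Fp 1 := f l.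
have dx l : differential (x l) = 0 by exact: cocycle_diff.
have [|A|A sA] := @word_system_exists G p _ x (fun _ _ => true) dx _ _ n.-1.
- move=> l l' _; apply: H2; rewrite differential_cup11 !dx.
  by apply: ev3_inj => g h k; rewrite !evE mul0r mulr0 subr0.
- move=> m sA; exists m => // w wn wr; apply: H2.
  by apply: (curvature_cocycle sA) => //; rewrite wn.
rewrite prednK ?(leq_trans _ n3) // in sA.
apply: (@massey_of_word_system G p _ x _ (fun i l => i == l :> nat) _ n f A sA) => //.
move=> i /andP[_ iN].
by rewrite (big_pred1 (Ordinal (iN : (i < n.+1)%N))).
Qed.

End Acyclic.

(** * The case of real places *)

Section RealCase.
Variable G : topologicalGroupType.
Local Notation Fp := (trivialModule G 'F_2).
Local Notation "'C^ n" := (cochain Fp n) (at level 8, n at level 2).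
Local Notation "'Z^ n" := (cocycle Fp n) (at level 8, n at level 2).
Local Notation "'H^ n" := (cohomology Fp n) (at level 8, n at level 2).

Variable chi : 'Z^1.
Hypothesis chi_surj : forall z : 'C^2, differential z = 0 ->
  exists b v : 'C^1, differential v = 0 /\ z = cup11 chi v + differential b.
Hypothesis chi_inj : forall z w : 'C^2, differential w = cup12 chi z ->
  exists y : 'C^1, z = differential y.
Hypothesis chi_square : forall x : 'Z^1,
  exists y : 'C^1, cup11 x x + cup11 chi x = differential y.

Definition cup_class (f g : 'Z^1) : 'H^2 := cohomology_class (cup1 f g).

Lemma oppC n (f : 'C^ n) : - f = f.
Proof. by apply/val_inj/funext => x; exact: (@oppFp2 2 (f x) erefl). Qed.

Lemma addC_eq n (u v w : 'C^ n) : u + v = w -> u = v + w.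
Proof. by move=> <-; rewrite addrCA -[X in _ + (_ + X)]oppC subrr addr0. Qed.

Lemma cup_classP (f g f' g' : 'Z^1) : cup_class f g = cup_class f' g' <->
  exists y : 'C^1, cup11 f g = cup11 f' g' + differential y.
Proof.
rewrite cohomology_classP /=; split=> -[y yE]; exists y.
  by rewrite -yE addrC subrK.
by rewrite -[LHS]/(cup11 f g - cup11 f' g') yE addrC addKr.
Qed.

Lemma cup_class_additive z : zmod_morphism (cup_class^~ z).
Proof.
move=> f g; rewrite /cup_class -raddfB /=; congr cohomology_class.
by apply/val_inj/ev2_inj => s t; rewrite -[LHS]/(ev2 (cup11 (f - g : 'C^1) z) s t)
  -[RHS]/(ev2 (cup11 f z - cup11 g z) s t) !evE mulrBl.
Qed.

Fact product_near (f g : 'C^1) (x : G) :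
  \forall y \near x, ev1 f y * ev1 g y = ev1 f x * ev1 g x.
Proof.
near=> y; have -> : ev1 f y = ev1 f x by near: y; exact: ev1_near.
by have -> // : ev1 g y = ev1 g x; near: y; exact: ev1_near.
Unshelve. all: by end_near. Qed.

Lemma cup12_diff (x : 'Z^1) (b : 'C^1) :
  cup12 x (differential b) = differential (cup11 x b).
Proof.
rewrite differential_cup11 cocycle_diff -[LHS]oppC.
by apply: ev3_inj => g h k; rewrite !evE mul0r sub0r.
Qed.

Lemma cup21_diff (b : 'C^1) (x : 'Z^1) :
  cup21 (differential b) x = differential (cup11 b x).
Proof.
rewrite differential_cup11 cocycle_diff.
by apply: ev3_inj => g h k; rewrite !evE mulr0 subr0.
Qed.

(** The coboundary of the pointwise product is - f g - g f. *)
Lemma cup11C (f g : 'Z^1) :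
  cup11 f g = cup11 g f + differential (mk1 (product_near f g)).
Proof.
transitivity (- cup11 g f - differential (mk1 (product_near f g))); last first.
  by rewrite -opprD oppC.
apply: ev2_inj => s t; have fM := (cocycle1P f).2 (cocycle_diff f) s t.
have gM := (cocycle1P g).2 (cocycle_diff g) s t.
rewrite !evE !ev_mk1 fM gM. ring_ev.
Qed.

Lemma cup12D (f : 'C^1) (u v : 'C^2) : cup12 f (u + v) = cup12 f u + cup12 f v.
Proof. apply: ev3_inj => g h k. ring_ev. Qed.

Lemma cup21D (f : 'C^1) (u v : 'C^2) : cup21 (u + v) f = cup21 u f + cup21 v f.
Proof. apply: ev3_inj => g h k. ring_ev. Qed.

Lemma cup11_perturb (X Y P S Q T : 'C^1) (M : 'C^2) :
  cup11 X (Y - P) + M + cup11 (S - Q) T =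
  cup11 X Y + M + cup11 S T - (cup11 X P + cup11 Q T).
Proof. apply: ev2_inj => g h. ring_ev. Qed.

(* Cupping with [chi] is injective on [H^2], so from [W] bounding
   [x c2 - c1 y = chi (x v2 - v1 y)] one may cancel [chi]. *)
Lemma chi_cancel (x y v1 v2 : 'Z^1) (c1 c2 : 'C^2) (b1 b2 : 'C^1) (W : 'C^2) :
  c1 = cup11 chi v1 + differential b1 -> c2 = cup11 chi v2 + differential b2 ->
  differential W = cup12 x c2 - cup21 c1 y ->
  cup_class x v2 = cup_class v1 y.
Proof.
move=> c1E c2E dW; pose m := mk1 (product_near x chi).
(* [m] accounts for moving [chi] in front of [x]; the last two terms absorb the coboundaries of [b2]
   and [b1]. *)
have := @chi_inj (cup11 x v2 + cup11 v1 y)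
  (W + cup11 m v2 + cup11 x b2 + cup11 b1 y).
case=> [|y' y'E]; last first.
  by apply/cup_classP; exists y'; exact: addC_eq.
have assoc1 : cup12 x (cup11 chi v2) =
    cup12 chi (cup11 x v2) + differential (cup11 m v2).
  by rewrite -cup11A (cup11C x chi) -/m cup21D cup21_diff cup11A.
rewrite !raddfD /= dW c1E c2E cup12D cup21D cup12D cup12_diff cup21_diff.
rewrite assoc1 cup11A.
rewrite opprD !oppC.
set u1 := cup12 _ _; set u2 := differential _; set u3 := differential _.
set u4 := cup12 _ _; set u5 := differential _.
transitivity (u1 + u4 + (u2 - u2) + (u3 - u3) + (u5 - u5)); last first.
  by rewrite !subrr !addr0.
rewrite !oppC; clearbody u1 u2 u3 u4 u5; apply: ev3_inj => g h k; rewrite !ev3D.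
move: (ev3 u1 _ _ _) (ev3 u2 _ _ _) (ev3 u3 _ _ _) (ev3 u4 _ _ _) (ev3 u5 _ _ _).
clear. move=> a b c d e; ring.
Qed.

(** Cup products are associative on cochains, so [chi] can be cancelled with W = 0. *)
Lemma cup_class_assoc x y z u v :
  cup_class x y = cup_class chi u -> cup_class y z = cup_class chi v ->
  cup_class u z = cup_class x v.
Proof.
move=> /cup_classP[b bE] /cup_classP[b' b'E]; symmetry.
apply: (chi_cancel (W := 0) bE b'E).
by rewrite raddf0 cup11A subrr.
Qed.

Lemma cup_class_sym x y : cup_class x y = cup_class y x.
Proof. by apply/cup_classP; exists (mk1 (product_near x y)); exact: cup11C. Qed.

Lemma cup_class_chi_surj h : exists u, h = cup_class chi u.
Proof.
have [z ->] := cohomology_class_surj h.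
have [b [v [dv zE]]] := chi_surj (cocycle_diff z).
have vZ : v \in @cocycle_pred G Fp 1 by apply/eqP.
exists (Cocycle vZ); apply/cohomology_classP; exists b.
by rewrite -[LHS]/((z : 'C^2) - cup11 chi v) zE addrC addKr.
Qed.

Lemma cup_class_square x : cup_class x x = cup_class chi x.
Proof.
have [y yE] := chi_square x; apply/cup_classP; exists y; exact: addC_eq.
Qed.

Lemma strong_massey_of_chi : strong_massey_vanishing G 2.
Proof.
move=> n a n3 aa; have [f fE] := choice (fun i => cohomology_class_surj (a i)).
have -> : a = (fun i => cohomology_class (f i)) by apply/funext.
have qB := cup_class_additive; have qC := cup_class_sym.
have qS := cup_class_chi_surj; have qA := cup_class_assoc.
have qI := cup_class_square.
have [i iN|J [e [t [c [eOS tN fsum cc]]]]] :=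
    orthogonal_decomposition qB qC qS qA qI (a := fun i => f i.+1) (N := n).
  by rewrite -[LHS]cupH_class -!fE aa.
(* Each position contributes one annihilated letter, its remainder in the decomposition. *)
pose x (l : J + 'I_n) : 'Z^1 := match l with inl j => e j | inr k => t k end.
have xT k : cup_class chi (x (inr k)) = 0 by apply: tN.
pose xC l : 'C^1 := x l.
have dx l : differential (xC l) = 0 by exact: cocycle_diff.
(* Positions count from 1 here and from 0 in the decomposition. *)
pose c' i (l : J + 'I_n) := if i is i'.+1 then
  match l with inl j => c i' j | inr k => k == i' :> nat end else false.
have c_r i l l' : c' i l -> c' i.+1 l' -> compatible l l'.
  case: i l l' => [|i] // [j|k] [j'|k'] //= cj cj'.
  by apply: contraNneq (cc i j) => jj; rewrite cj jj.
have [l l' ll'|m A sA|A sA] := word_system_exists (r := @compatible J 'I_n) dx _ _ n.-1.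
- have /cup_classP[y yE] : cup_class (x l) (x l') = cup_class 0 0.
    rewrite (compatible_orth qB qC qS qA eOS xT ll').
    by rewrite -[X in cup_class X _](subrr 0) qB subrr.
  exists y; rewrite yE -[RHS]add0r; congr (_ + _).
  by apply: ev2_inj => g h; rewrite !evE mul0r.
(* By surjectivity the obstruction at [w] is [chi * v w], up to a coboundary. *)
- have [w|v vE] := @choice _ _ (fun w (v : 'Z^1) => size w = m.+3 ->
      sorted (@compatible J 'I_n) w ->
      exists b : 'C^1, curvature A w = cup11 chi v + differential b).
    have [/andP[/eqP wm wr]|wmr] :=
      boolP ((size w == m.+3) && sorted (@compatible J 'I_n) w).
      have [|b [v [dv vE]]] := chi_surj (z := curvature A w).
        by apply: (curvature_cocycle sA) => //; rewrite wm.
      have vZ : v \in @cocycle_pred G Fp 1 by apply/eqP.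
      by exists (Cocycle vZ) => _ _; exists b.
    by exists 0 => wm wr; move: wmr; rewrite wm wr eqxx.
  have [l z l' zm wr|g gE] := correction qB qC qS qA qI eOS xT (m := m.+1) (v := v).
    have [W dW] := juggling dx sA zm wr.
    have [b1 b1E] : exists b,
        curvature A (l :: z) = cup11 chi (v (l :: z)) + differential b.
      apply: vE; first by rewrite /= zm.
      have := take_sorted (size z).+1 wr.
      by rewrite /= -cats1 take_size_cat.
    have [b2 b2E] : exists b, curvature A (rcons z l') =
        cup11 chi (v (rcons z l')) + differential b.
      apply: vE; first by rewrite size_rcons zm.
      exact: path_sorted wr.
    exact: (chi_cancel b1E b2E dW).
  (* Subtracting cocycles on the longest words preserves the equations already solved. *)
  pose A' w := if size w == m.+2 then A w - (g w : 'C^1) else A w.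
  have A'E w : size w != m.+2 -> A' w = A w by rewrite /A' => /negPf->.
  exists A'.
    split=> [l|w /andP[w0 wm] wr]; first by rewrite A'E // sA.1.
    rewrite (eq_curvature (A' := A)) => [|u /andP[_ uw]]; last first.
      by rewrite A'E // ltn_eqF // (leq_trans uw).
    rewrite -sA.2 ?w0 // /A'; case: ifP => // _.
    by rewrite raddfB /= cocycle_diff subr0.
  case=> [|l w] //= [wm]; case/lastP: w wm => [|z l'] //.
  rewrite size_rcons => -[zm] wr.
  have [|b bE] := vE (l :: rcons z l') _ wr; first by rewrite /= size_rcons zm.
  have zE : (size z = m.+1)%N by [].
  have [b1 b1E] : exists b1 : 'C^1, cup11 chi (v (l :: rcons z l')) =
      cup11 (xC l) (g (rcons z l')) + cup11 (g (l :: z)) (xC l')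
      + differential b1.
    have := gE _ _ _ zE wr; rewrite /cup_class -raddfD.
    move=> /cohomology_classP[b1 b1E].
    by exists b1; rewrite -b1E addrC subrK.
  exists (b + b1).
  have A's : A' (rcons z l') = A (rcons z l') - (g (rcons z l') : 'C^1).
    by rewrite /A' size_rcons zE eqxx.
  have A'p : A' (l :: z) = A (l :: z) - (g (l :: z) : 'C^1).
    by rewrite /A' /= zE eqxx.
  rewrite (curvature_ends _ _ _ zE) A's A'p !A'E ?sA.1 //.
  set w := l :: rcons z l' in wr bE b1E *.
  (* The inner terms involve only words too short to be changed. *)
  have -> : \sum_(2 <= k < m.+2) cup11 (A' (take k w)) (A' (drop k w)) =
      \sum_(2 <= k < m.+2) cup11 (A (take k w)) (A (drop k w)).
    have wE : size w = m.+3 by rewrite /= size_rcons zE.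
    apply: eq_big_nat => k kP; rewrite !A'E ?size_take_min ?size_drop ?wE //.
      by move: kP; clear; lia.
    by move: kP; clear; lia.
  move: bE; rewrite (curvature_ends _ _ _ zE) !sA.1 b1E.
  set M := \sum_(_ <= _ < _) _; set u := cup11 (xC l) (g _); set u' := cup11 (g _) _.
  have cancel (U D1 D : 'C^2) : U + D1 + D - U = D + D1.
    by rewrite addrAC [U + D1]addrC addrK addrC.
  move=> bE; transitivity (differential b + differential b1); last first.
    by rewrite -(raddfD (@differential G Fp 1)).
  rewrite -(cancel (u + u') (differential b1) (differential b)) -bE /u /u'.
  exact: cup11_perturb.
rewrite prednK ?(leq_trans _ n3) // in sA.
apply: (massey_of_word_system c_r sA) => -[//|i] /andP[_ iN].
rewrite fsum -[LHS]/(val _) raddfD raddf_sum big_sumType /=; congr (_ + _).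
by rewrite (big_pred1 (Ordinal iN)).
Qed.

End RealCase.

Theorem theorem1p7 (K : fieldType) (Ki : fieldExtType K) (i : Ki)
    (hi : i ^+ 2 = -1) (hKi : <<1%AS; i>>%VS = {:Ki}%VS)
    (hcd : field_cd_le Ki 1) :
  forall p : nat, prime p -> p \notin [pchar K] -> strong_massey_conjecture K p.
Proof.
move=> p p_prime _ L iota sepL.
have [iota' [j [jE iotaE galgE]]] := extend_to_adjoin_i hi hKi sepL.
have cdH := hcd L iota' (separable_closure_extend sepL iotaE).
have SM := fixes_iM jE (iota := iota); have Snear := @fixes_i_near _ _ iota j.
have Sacyclic := fixes_i_acyclic jE galgE p_prime cdH.
(* If every automorphism fixes [j], the stabilizer is the whole group and its H^2 vanishes. *)
have [ST|/existsNP[tau /negP tauS]] := pselect (forall g, fixes_i (iota := iota) j g).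
  by apply: strong_massey_of_H2_eq0 => z; exact: (H2_eq0_full Sacyclic ST).
have [p2|p_odd] := eqVneq p 2%N; last first.
  apply: strong_massey_of_H2_eq0 => z.
  apply: (H2_eq0_odd SM Snear Sacyclic tauS).
  rewrite -(dvdn_pcharf (pchar_Fp p_prime)); apply: contraNN p_odd => p2.
  by rewrite eqn_leq dvdn_leq // prime_gt1.
(* [tau] maps [j] to -j, which differs from [j], so the characteristic is not two. *)
subst p; have L2 : (2%:R : L) != 0.
  apply/eqP => L2; have := tauS; rewrite {1}/fixes_i (galg_i jE) (negPf tauS).
  by rewrite eq_sym -addr_eq0 -mulr2n -mulr_natl L2 mul0r eqxx.
have chiZ : chi 2 Snear \in @cocycle_pred _ _ 1.
  by apply/eqP; exact: (chi_cocycle SM Snear erefl).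
apply: (@strong_massey_of_chi _ (Cocycle chiZ)).
- exact: (cup_chi_surj SM Snear Sacyclic tauS erefl).
- exact: (cup_chi_inj SM Sacyclic tauS erefl).
- by move=> x; exact: (cup_square sepL (cocycle_diff x) jE L2).
Qed.
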